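(* Let $T>0$, let $W$ be a (standard, real) Brownian motion on $[0,T]$, and let $$b(x)=\begin{cases}\sqrt{x},& x\ge0,\\ \sqrt{-x}+1,& x<0.\end{cases}$$ Let $\bar Y_t:=\lim_{m\to\infty}Y^{(m)}_t$, $t\in[0,T]$, where $Y^{(m)}$ are the approximating processes defined in the context. Then the process $\bar Y$ is the unique path-by-path solution of the equation $$Y_t=\int_0^t b(Y_s+W_s)\,ds,\qquad t\in[0,T].$$
   Context: Path-by-path solution: the equation is solved $\omega$-by-$\omega$, i.e. for each fixed continuous sample path $\omega_\cdot$ of $W$ one considers the deterministic equation $y_t=\int_0^t b(y_s+\omega_s)\,ds$, $t\in[0,T]$, with continuous unknown $y\colon[0,T]\to\mathbb R$. That $\bar Y$ is the unique path-by-path solution means: for almost all sample paths of $W$, the corresponding path of $\bar Y$ is a solution of this deterministic equation and is its only solution on $[0,T]$. Construction of $Y^{(m)}$. For $n\in\mathbb N$, $n\ge1$, let $$b_n(x)=\begin{cases}\sqrt{x}-\frac1n,& x>0,\\ \sqrt{-x}+1-\frac1n,& x<-\frac1n,\\ -(n+\sqrt n)x-\frac1n,& -\frac1n\le x\le0,\end{cases}$$ let $\varepsilon_n=\frac{1}{2n(n+1)}$, and let $p_n$ be a polynomial such that $|b_n(x)-p_n(x)|<\varepsilon_n$ for $x\in[-n,n]$, redefined outside $[-n,n]$ by $p_n(x)\equiv p_n(n)$ for $x\ge n$ and $p_n(x)\equiv p_n(-n)$ for $x\le -n$ (so $p_n$ is bounded and Lipschitz on $\mathbb R$). Let $(\tilde\varepsilon_m)_{m\ge1}$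 be a sequence of positive numbers with $\tilde\varepsilon_m\downarrow0$ as $m\to\infty$. Then $Y^{(m)}$ is the unique solution of $$Y^{(m)}_t=-\tilde\varepsilon_m+\int_0^t p_m(Y^{(m)}_s+W_s)\,ds,\qquad t\in[0,T].$$ The sequence $Y^{(m)}_t$ is non-decreasing in $m$ and the limit $\bar Y_t$ is well defined. *)

(* Defs.v *)
From HB Require Import structures.
From mathcomp Require Import all_boot all_order all_algebra.
From mathcomp Require Import all_classical all_reals all_analysis.

Set Implicit Arguments.
Unset Strict Implicit.
Unset Printing Implicit Defensive.

Import Order.TTheory GRing.Theory Num.Theory.
Import numFieldNormedType.Exports.

Local Open Scope classical_set_scope.
Local Open Scope ring_scope.

(* Processes on [0, T] are families indexed by all of R; only the indices in
   [0, T] are ever constrained or used. *)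

Definition increment {d} {Omega : measurableType d} {R : realType}
    {P : probability Omega R} (W : R -> {RV P >-> R}) (s t : R) (w : Omega) : R :=
  W t w - W s w.

(* [normal_prob m s] has mean [m] and standard deviation [s]; it is only used
   for s > 0 below. In [bm_indep], subfamilies are covered by B i = setT. *)
Record brownian_motion {d} {Omega : measurableType d} {R : realType}
    {P : probability Omega R} (T : R) (W : R -> {RV P >-> R}) : Prop := {
  bm_start : {ae P, forall w, W 0 w = 0} ;
  bm_continuous :
    {ae P, forall w, {within `[0, T], continuous (fun t => W t w)}} ;
  bm_gaussian : forall s t : R, 0 <= s -> s < t -> t <= T ->
    forall B : set R, measurable B ->
    P (increment W s t @^-1` B) = normal_prob 0 (Num.sqrt (t - s)) B ;
  bm_indep : forall (n : nat) (t : nat -> R),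
    0 <= t 0%N -> t n <= T ->
    (forall i : nat, (i < n)%N -> t i < t i.+1) ->
    forall B : nat -> set R, (forall i : nat, measurable (B i)) ->
    P [set w | forall i : nat, (i < n)%N ->
                 B i (increment W (t i) (t i.+1) w)] =
    (\prod_(i < n) P (increment W (t i) (t i.+1) @^-1` B i))%E
}.

(* For the locally bounded Borel drifts used below and a path [w] continuous on
   [0, T], the integrand is bounded and measurable on [0, t], hence the
   (real-valued) Lebesgue integral is a genuine one. *)
Definition is_path_solution {R : realType} (f : R -> R) (T y0 : R)
    (w y : R -> R) : Prop :=
  {within `[0, T], continuous y} /\
  forall t, t \in `[0, T] ->
    y t = y0 + \int[lebesgue_measure]_(s in `[0, t]) f (y s + w s).

Definition unique_path_by_path_solution {d} {Omega : measurableType d}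
    {R : realType} {P : probability Omega R} (f : R -> R) (T : R)
    (W : R -> {RV P >-> R}) (Y : R -> Omega -> R) : Prop :=
  {ae P, forall w,
    is_path_solution f T 0 (fun t => W t w) (fun t => Y t w) /\
    forall y : R -> R, is_path_solution f T 0 (fun t => W t w) y ->
      forall t, t \in `[0, T] -> y t = Y t w}.

Definition drift {R : realType} (x : R) : R :=
  if 0 <= x then Num.sqrt x else Num.sqrt (- x) + 1.

Definition drift_n {R : realType} (n : nat) (x : R) : R :=
  if 0 < x then Num.sqrt x - n%:R^-1
  else if x < - n%:R^-1 then Num.sqrt (- x) + 1 - n%:R^-1
  else - (n%:R + Num.sqrt n%:R) * x - n%:R^-1.

Definition eps_n {R : realType} (n : nat) : R := (2 * n%:R * (n%:R + 1))^-1.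

(* The polynomial [q] on [-n, n], extended by constants outside. *)
Definition frozen_poly {R : realType} (n : nat) (q : {poly R}) (x : R) : R :=
  if n%:R <= x then q.[n%:R]
  else if x <= - n%:R then q.[- n%:R]
  else q.[x].

(* Main.v *)
Require Import Defs.
From HB Require Import structures.
From mathcomp Require Import all_boot all_order all_algebra.
From mathcomp Require Import all_classical all_reals all_analysis.
From mathcomp Require Import measurable_realfun.
From mathcomp Require Import zify ring lra.

Set Implicit Arguments.
Unset Strict Implicit.
Unset Printing Implicit Defensive.

Import Order.TTheory GRing.Theory Num.Theory.
Import numFieldNormedType.Exports.

Local Open Scope classical_set_scope.
Local Open Scope ring_scope.

(** The drift [b = drift] is one-sided Lipschitz except where its argument is
    small and positive: it decreases on the negative axis, its jump at 0 goes
    down, and on the positive axis [sqrt (x + D) - sqrt x <= D / sqrt x].  So if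
    [z] is a solution along a path [w], [X = w + z], and [y] is another solution,
    then [|y - z|] grows at rate at most [|y - z| / sqrt |X|] as long as
    [|y - z| < 1] and [X <> 0] (drift_increment_right, drift_increment_left).
    If [1 / sqrt |X|] is integrable in time, a Gronwall argument
    (gronwall_nonpos) gives [y = z].

    Solutions are Lipschitz, with a constant depending on the path.  Hence it is
    enough to show that almost surely, for every Lipschitz [y], the sum [w + y]
    spends so little time near 0 that [|w + y| ^ (-1/2)] is integrable
    (ae_sparse_near_zero, integrable_inv_sqrt).  The exceptional null set does
    not depend on [y], and the rest of the argument is about one fixed path.
    Precisely, the time spent in [{|w + y| <= r}] is [O (r ^ a)] for some
    [a > 1/2], along a geometric sequence of radii [r].

    The time spent near 0 is estimated by zooming twice.  Over an interval of
    length [1 / N ^ 10] (lengths are in units of [T]) a Lipschitz [y] moves by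
    [O (1 / N ^ 10)].  Cut the interval in [N ^ 20] cells of length
    [1 / N ^ 30].  If [w + y] is small at some time of a cell, then the value of
    [w] at the left end of the cell is within [O (1 / N ^ 10)] of one number
    common to the whole interval; here the Hoelder exponent 1/3 of [w] enters
    (ae_holder_grid), as [N ^ 10] is the cube root of [N ^ 30].  The typical
    number of such cells is a local time of order [N ^ 15], and almost surely it
    is at most [N ^ 16] for all intervals, all values and all large [N = 2 ^ n]
    (ae_uncrowded).  Applying this with [N] and then with [N ^ 3] leaves at
    most [N ^ 10 * N ^ 16 * N ^ 48 = N ^ 74] out of [N ^ 90] cells in which
    [|w + y|] gets below [1 / N ^ 30] (nvisits_le), that is, a time
    [T / N ^ 16] at radius [r = 1 / N ^ 30], and 16/30 exceeds 1/2.  One zoom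
    alone would give at best the exponent 1/2.

    To bound the number of crowded cells, consider chains of 16 increasing grid
    times with consecutive values of [w] close to each other.  Many cells near a
    common value force many chains, whatever the value is, so that no supremum
    over values has to be controlled.  The expected number of chains factorizes
    by independence of increments (integral_chains_le).

    Finally the limit of the approximating solutions is a solution: the
    regularized drifts increase strictly with the index, so the solutions
    increase (strict_comparison); they are Lipschitz uniformly in the index, so
    the limit [z] is Lipschitz and [w + z] vanishes on a null set only; off that
    set the regularized drifts converge along the solutions
    (frozen_poly_cvg), and dominated convergence concludes
    (limit_path_solution). *)

(** * Gaussian estimates and the Borel-Cantelli lemma *)

Lemma ge0_integral_le_cst d (X : measurableType d) (R : realType)
    (mu : {measure set X -> \bar R}) (D : set X) (f : X -> R) (c : R) :
  measurable D -> measurable_fun D f ->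
  (forall x, D x -> 0 <= f x <= c) ->
  (\int[mu]_(x in D) (f x)%:E <= c%:E * mu D)%E.
Proof.
move=> mD mf fc; rewrite -integral_cst//.
apply: ge0_le_integral => //.
- by move=> x /fc /andP[? _]; rewrite lee_fin.
- exact/measurable_EFinP.
- by move=> x /fc /andP[_ ?]; rewrite lee_fin.
Qed.

Lemma normal_pdf0E {R : realType} (s x : R) : s != 0 ->
  normal_pdf 0 s x = normal_peak s * expR (- x ^+ 2 / (s ^+ 2 *+ 2)).
Proof. by move=> s0; rewrite normal_pdfE// /normal_fun subr0. Qed.

Lemma normal_prob_ball {R : realType} (s r : R) : 0 < s -> 0 <= r ->
  (normal_prob 0 s [set x : R | (`|x| <= r)%R] <= (2 * r / s)%:E)%E.
Proof.
move=> s0 r0.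
have -> : [set x : R | `|x| <= r] = `[- r, r]%classic.
  by apply/seteqP; split => x /=; rewrite in_itv /= ler_norml.
have lB : lebesgue_measure (`[- r, r]%classic : set R) = (2 * r)%:E.
  rewrite lebesgue_measure_itv /= lte_fin; case: ltrP => h.
    by rewrite -EFinD; congr EFin; ring.
  by congr EFin; lra.
rewrite /normal_prob.
rewrite mulrC EFinM -lB; apply: ge0_integral_le_cst.
- exact: measurable_itv.
- by apply: measurable_funTS; exact: measurable_normal_pdf.
- move=> x _; rewrite normal_pdf_ge0.
  apply: (le_trans (normal_pdf_ub 0 x _)); first by rewrite gt_eqF.
  rewrite /normal_peak lef_pV2 ?posrE//; last first.
    by rewrite sqrtr_gt0 mulrn_wgt0// mulr_gt0// ?pi_gt0// exprn_gt0.
  rewrite -[leLHS](gtr0_norm s0) -(sqrtr_sqr s) -mulrnAr.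
  rewrite ler_sqrt ?mulr_ge0 ?sqr_ge0//; last by rewrite mulrn_wge0// pi_ge0.
  rewrite ler_peMr ?sqr_ge0//.
  - by have := pi_ge2 R; lra.
  - exact: ltW.
  - exact: ltW.
Qed.

(** Comparing with the density of twice the variance leaves half of the
    Gaussian exponent to pay for the distance to the mean. *)
Lemma normal_prob_tail {R : realType} (s r : R) : 0 < s -> 0 <= r ->
  (normal_prob 0 s [set x : R | (r < `|x|)%R] <=
     (2 * expR (- (r ^+ 2 / (4 * s ^+ 2))))%:E)%E.
Proof.
move=> s0 r0.
set B := [set x : R | r < `|x|].
have mB : measurable (B : set R).
  rewrite (_ : B = ~` `[- r, r]%classic); first by apply: measurableC; exact: measurable_itv.
  apply/seteqP; split => x; rewrite /B /= in_itv /= -ler_norml.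
    by rewrite ltNge => /negP.
  by rewrite ltNge => /negP.
set C := 2 * _.
have C0 : 0 <= C by rewrite mulr_ge0// expR_ge0.
pose s2 := s * Num.sqrt 2.
have s20 : 0 < s2 by rewrite mulr_gt0// sqrtr_gt0.
have key x : B x -> normal_pdf 0 s x <= C * normal_pdf 0 s2 x.
  rewrite /B /= => rx.
  rewrite !normal_pdf0E ?gt_eqF// mulrCA.
  have E2 : s2 ^+ 2 = 2 * s ^+ 2 by rewrite exprMn sqr_sqrtr// mulrC.
  have pk : normal_peak s <= 2 * normal_peak s2.
    rewrite /normal_peak E2.
    have -> : 2 * s ^+ 2 * pi *+ 2 = 2 * (s ^+ 2 * pi *+ 2) by rewrite -!mulrA mulrnAr.
    rewrite sqrtrM// invfM mulrA ler_peMl ?invr_ge0 ?sqrtr_ge0//.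
    rewrite ler_pdivlMr ?sqrtr_gt0// mul1r.
    rewrite -[leRHS]ger0_norm// -sqrtr_sqr ler_sqrt//; lra.
  rewrite [leRHS](_ : _ = (2 * normal_peak s2) *
     (expR (- (r ^+ 2 / (4 * s ^+ 2))) * expR (- x ^+ 2 / (s2 ^+ 2 *+ 2)))); last first.
    by rewrite /C; ring.
  apply: ler_pM => //; rewrite ?normal_peak_ge0 ?expR_ge0//.
  rewrite -expRD ler_expR E2.
  have x2 : r ^+ 2 <= x ^+ 2.
    by rewrite -[x ^+ 2]real_normK ?num_real// ler_pXn2r ?nnegrE// ltW.
  have -> : - (r ^+ 2 / (4 * s ^+ 2)) + - x ^+ 2 / (2 * s ^+ 2 *+ 2) =
    - (r ^+ 2 + x ^+ 2) / (4 * s ^+ 2) by field; rewrite gt_eqF.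
  have -> : - x ^+ 2 / (s ^+ 2 *+ 2) = - (x ^+ 2 + x ^+ 2) / (4 * s ^+ 2).
    by field; rewrite gt_eqF.
  rewrite ler_pM2r ?invr_gt0 ?mulr_gt0 ?exprn_gt0//; lra.
apply: (@le_trans _ _ (\int[lebesgue_measure]_(x in setT) (C%:E * (normal_pdf 0 s2 x)%:E))%E).
  rewrite /normal_prob.
  apply: (@le_trans _ _ (\int[lebesgue_measure]_(x in B) (C%:E * (normal_pdf 0 s2 x)%:E))%E).
    apply: ge0_le_integral => //=.
    - by move=> x _; rewrite lee_fin normal_pdf_ge0.
    - by apply/measurable_EFinP/measurable_funTS; exact: measurable_normal_pdf.
    - under eq_fun do rewrite -EFinM.
      apply/measurable_EFinP/measurable_funTS/measurable_funM => //.
      exact: measurable_normal_pdf.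
  apply: (@ge0_subset_integral _ _ _ lebesgue_measure B setT mB measurableT) => //.
    under eq_fun do rewrite -EFinM.
    apply/measurable_EFinP/measurable_funM => //.
    exact: measurable_normal_pdf.
  by move=> x _; rewrite mule_ge0// lee_fin ?normal_pdf_ge0.
rewrite ge0_integralZl//=.
- by rewrite integral_normal_pdf mule1.
- by apply/measurable_EFinP; exact: measurable_normal_pdf.
- by move=> x _; rewrite lee_fin normal_pdf_ge0.
Qed.

(** Borel-Cantelli with a geometric rate, in the form in which it is applied
    to paths. *)
Lemma ae_eventually d (Omega : measurableType d) (R : realType)
    (P : probability Omega R) (F : nat -> set Omega) (C : R) (n1 : nat) :
  (forall n, (n1 <= n)%N -> measurable (F n)) ->
  (forall n, (n1 <= n)%N -> (P (F n) <= (C * 2^-1 ^+ n)%:E)%E) ->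
  {ae P, forall w, exists n0, forall n, (n0 <= n)%N -> ~ F n w}.
Proof.
move=> mF PF.
pose G n := F (n1 + n)%N.
have C0 : 0 <= C.
  have := le_trans (measure_ge0 P (F n1)) (PF n1 (leqnn _)).
  by rewrite lee_fin pmulr_lge0// exprn_gt0.
exists (lim_sup_set G); split.
- by apply: bigcap_measurable => // k _; apply: bigcup_measurable => j _; exact/mF/leq_addr.
- apply: lim_sup_set_cvg0 => [n|]; first exact/mF/leq_addr.
  apply: (@le_lt_trans _ _ (\sum_(n <oo) (C * 2^-1 ^+ n)%:E)%E).
    apply: lee_nneseries => n _ //.
    apply: (le_trans (PF _ (leq_addr _ _))).
    rewrite lee_fin ler_wpM2l// exprD ler_piMl ?exprn_ge0// exprn_ile1//; lra.
  have /cvg_lim h := @cvg_geometric_eseries_half R (2 * C) 0.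
  rewrite (_ : (\sum_(n <oo) _)%E =
      (\sum_(0 <= k <oo) (2 * C / (2 ^ (k + 1))%:R)%:E)%E); last first.
    apply: eq_eseriesr => k _; congr EFin.
    by rewrite addn1 natrX exprS exprVn; field; rewrite expf_neq0.
  by rewrite h// ltry.
- move=> w /=; apply: contra_notP => wG.
  have {wG} : ~ (forall n, True -> (\bigcup_(j >= n) G j) w) by exact: wG.
  move=> /existsNP[n /not_implyP[_ wn]]; exists (n1 + n)%N => m nm Fm.
  apply: wn; exists (m - n1)%N => /=; first by lia.
  by rewrite /G subnKC//; lia.
Qed.

(** * Chains of close values *)

(** The number of index sequences [j < l_1 < ... < l_k < m] along which [v]
    moves by at most [rho] at each step. *)
Fixpoint chains {R : realType} (rho : R) (v : nat -> R) (m k j : nat) : nat :=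
  if k is k'.+1 then
    \sum_(j.+1 <= l < m | `|v l - v j| <= rho) chains rho v m k' l
  else 1%N.

(** Sorting the subsets of [k.+1] elements of [S] by their least element. *)
Lemma hockey_stick_count (S : pred nat) (m k j : nat) : (j <= m)%N ->
  (\sum_(j <= l < m | S l) 'C(count S (index_iota l.+1 m), k))%N =
  'C(count S (index_iota j m), k.+1).
Proof.
move=> jm; rewrite -(subKn jm); move: (m - j)%N (leq_subr j m) => i.
elim: i => [_|i IH im]; first by rewrite subn0 /index_iota subnn /= big_nil.
have E : (m - i.+1 < m)%N by lia.
rewrite big_ltn_cond//.
have -> : (m - i.+1).+1 = (m - i)%N by lia.
rewrite IH; last by lia.
have -> : index_iota (m - i.+1) m = (m - i.+1)%N :: index_iota (m - i) m.
  rewrite /index_iota (_ : m - (m - i.+1) = (m - (m - i)).+1)%N /=; last by lia.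
  by congr (_ :: iota _ _); lia.
by rewrite /=; case: ifP => _ //=; rewrite add1n binS addnC.
Qed.

(** Any increasing selection inside a set of pairwise close values is a chain,
    so crowding is detected without knowing around which value it occurs. *)
Lemma bin_le_chains {R : realType} (rho : R) (v : nat -> R) (m : nat) (S : pred nat) :
  (forall i j, S i -> S j -> `|v i - v j| <= rho) ->
  forall k j, (j < m)%N -> S j ->
  ('C(count S (index_iota j.+1 m), k) <= chains rho v m k j)%N.
Proof.
move=> Sclose; elim => [|k IH] j jm Sj /=; first by rewrite bin0.
rewrite -hockey_stick_count//.
rewrite [X in (X <= _)%N]big_nat_cond [X in (_ <= X)%N]big_nat_cond.
rewrite [X in (_ <= X)%N](bigID S) /=; apply: leq_trans (leq_addr _ _).
rewrite [X in (_ <= X)%N](eq_bigl (fun l => (j < l < m)%N && S l)); last first.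
  move=> l; rewrite -andbA; case: (boolP (S l)) => Sl; rewrite ?andbF// andbT.
  by rewrite Sclose// andbT.
by apply: leq_sum => l /andP[/andP[_ lm] Sl]; exact: IH.
Qed.

Lemma bin_le_sum_chains {R : realType} (rho : R) (v : nat -> R) (m : nat) (S : pred nat) k :
  (forall i j, S i -> S j -> `|v i - v j| <= rho) ->
  ('C(count S (iota 0 m), k.+1) <= \sum_(0 <= j < m) chains rho v m k j)%N.
Proof.
move=> Sclose; rewrite -{1}(subn0 m) -/(index_iota 0 m) -hockey_stick_count//.
rewrite [X in (X <= _)%N]big_nat_cond [X in (_ <= X)%N]big_nat_cond.
rewrite [X in (_ <= X)%N](bigID S) /=; apply: leq_trans (leq_addr _ _).
rewrite (eq_bigl (fun l => (0 <= l < m)%N && true && S l)); last first.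
  by move=> l; rewrite andbT.
by apply: leq_sum => l /andP[/andP[lm _] Sl]; apply: bin_le_chains => //; case/andP: lm.
Qed.

Lemma expn_le_bin (M q : nat) : (2 * q <= M)%N ->
  (M ^ q <= 2 ^ q * q`! * 'C(M, q))%N.
Proof.
move=> qM; rewrite -mulnA [(q`! * _)%N]mulnC bin_ffact.
have H i : (i <= q)%N -> (M ^ i <= 2 ^ i * M ^_ i)%N.
  elim: i => [//|i IH] iq; rewrite !expnS ffactnSr.
  rewrite [(M * _)%N]mulnC (mulnC 2) -mulnA (mulnCA _ (M ^_ i)) mulnA.
  by apply: leq_mul; [apply: IH; lia|lia].
exact: H.
Qed.

(** * Expected number of chains along a Brownian path *)

Definition small_increment {d} {Omega : measurableType d} {R : realType}
    {P : probability Omega R} (W : R -> {RV P >-> R}) (rho s t : R) : set Omega :=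
  [set w | `|increment W s t w| <= rho].

Definition small_increments {d} {Omega : measurableType d} {R : realType}
    {P : probability Omega R} (W : R -> {RV P >-> R}) (rho : R) (n : nat)
    (t : nat -> R) : set Omega :=
  [set w | forall i, (i < n)%N -> `|increment W (t i) (t i.+1) w| <= rho].

Lemma measurable_increment d (Omega : measurableType d) (R : realType)
    (P : probability Omega R) (W : R -> {RV P >-> R}) (s t : R) :
  measurable_fun setT (increment W s t).
Proof. by apply: measurable_funB; exact: measurable_funPT. Qed.

Lemma measurable_small_increment d (Omega : measurableType d) (R : realType)
    (P : probability Omega R) (W : R -> {RV P >-> R}) (s t rho : R) :
  measurable (small_increment W rho s t).
Proof.
have : measurable_fun setT (fun w => `|increment W s t w|).
  exact: measurableT_comp (measurable_increment W s t).
move=> /(_ measurableT `]-oo, rho]%classic (measurable_itv _)); rewrite setTI.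
by congr measurable; apply/seteqP; split => w /=; rewrite in_itv.
Qed.

Lemma measurable_small_increments d (Omega : measurableType d) (R : realType)
    (P : probability Omega R) (W : R -> {RV P >-> R}) rho n t :
  measurable (small_increments W rho n t).
Proof.
rewrite (_ : small_increments _ _ _ _ = \bigcap_(i < n)
  small_increment W rho (t i) (t i.+1)); last by [].
by apply: bigcap_measurableType => i _; exact: measurable_small_increment.
Qed.

Lemma measurable_ball0 {R : realType} (r : R) : measurable [set x : R | `|x| <= r].
Proof.
rewrite (_ : mkset _ = `[- r, r]%classic); first exact: measurable_itv.
by apply/seteqP; split => x /=; rewrite in_itv /= ler_norml.
Qed.

(** Smallness of successive increments is an event about a rectangle, so the
    independence of increments applies to it directly. *)
Lemma prob_small_increments d (Omega : measurableType d) (R : realType)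
    (P : probability Omega R) (T : R) (W : R -> {RV P >-> R}) (rho s : R)
    (n : nat) (t : nat -> R) :
  brownian_motion T W -> 0 <= t 0%N -> (forall i, (i < n)%N -> t i < t i.+1) ->
  t n < s -> s <= T ->
  P (small_increments W rho n t `&` small_increment W rho (t n) s) =
  (P (small_increments W rho n t) * P (small_increment W rho (t n) s))%E.
Proof.
move=> bm t0 tinc tns sT.
pose B (_ : nat) := [set x : R | `|x| <= rho].
have mB i : measurable (B i) by exact: measurable_ball0.
rewrite [P (small_increments _ _ _ _)](bm_indep bm t0 _ tinc mB); last exact: ltW (lt_le_trans tns sT).
pose t' i := if (i <= n)%N then t i else s.
have t'0 : 0 <= t' 0%N by [].
have t'n : t' n.+1 <= T by rewrite /t' ltnn.
have t'inc i : (i < n.+1)%N -> t' i < t' i.+1.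
  rewrite ltnS leq_eqVlt => /orP[/eqP ->|ni].
    by rewrite /t' leqnn ltnn.
  by rewrite /t' ni (ltnW ni) tinc.
have := bm_indep bm t'0 t'n t'inc mB.
have t'Sn : t' n.+1 = s by rewrite /t' ltnn.
have t'nn : t' n = t n by rewrite /t' leqnn.
rewrite big_ord_recr /= t'Sn t'nn => E.
transitivity (P [set w | forall i, (i < n.+1)%N -> B i (increment W (t' i) (t' i.+1) w)]).
  congr (P _); apply/seteqP; split => w /=.
    move=> [wA wn] i; rewrite ltnS leq_eqVlt => /orP[/eqP ->|ni].
      by rewrite /t' leqnn ltnn.
    by rewrite /t' ni (ltnW ni); exact: wA.
  move=> wA; split => [i ni|].
    by have := wA i (ltnW ni); rewrite /t' ni (ltnW ni).
  by have := wA n (leqnn _); rewrite /t' leqnn ltnn.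
rewrite E; congr (_ * _)%E.
by apply: eq_bigr => i _; rewrite /t' (ltn_ord i) (ltnW (ltn_ord i)).
Qed.

Lemma chainsS {R : realType} (rho : R) v m k j :
  (chains rho v m k.+1 j)%:R =
  \sum_(j.+1 <= l < m) (\1_[set l | `|v l - v j| <= rho] l * (chains rho v m k l)%:R) :> R.
Proof.
rewrite /= natr_sum big_mkcond; apply: eq_bigr => l _.
by rewrite indicE; case: ifPn => h; [rewrite mem_set// mul1r|
  rewrite memNset ?mul0r//=; exact/negP].
Qed.

Lemma measurable_chains d (Omega : measurableType d) (R : realType)
    (P : probability Omega R) (W : R -> {RV P >-> R}) (rho : R) (tau : nat -> R) m k j :
  measurable_fun setT
    (fun w => (chains rho (fun i => W (tau i) w) m k j)%:R : R).
Proof.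
elim: k j => [|k IH] j /=; first exact: measurable_cst.
under eq_fun do rewrite (chainsS rho (fun i => W (tau i) _)).
apply: measurable_sum => l; apply: measurable_funM; last exact: IH.
rewrite (_ : (fun w => _) = \1_(small_increment W rho (tau j) (tau l))); last first.
  by apply/funext => w; rewrite !indicE; congr ((_ : bool)%:R); apply/idP/idP => /set_mem h; apply/mem_set.
by apply: measurable_indic; exact: measurable_small_increment.
Qed.

(** The chains are integrated on the event that earlier increments are small.
    This event absorbs the first step of each chain, which makes the induction on
    the length of chains go through; [G] bounds the expected number of close
    later times seen from any given one. *)
Lemma integral_chains_le d (Omega : measurableType d) (R : realType)
    (P : probability Omega R) (T : R) (W : R -> {RV P >-> R}) (rho : R)
    (tau : nat -> R) (m : nat) (G : R) :
  brownian_motion T W -> 0 <= G ->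
  (forall j, (j < m)%N -> 0 <= tau j <= T) ->
  (forall i j, (i < j < m)%N -> tau i < tau j) ->
  (forall j, (j < m)%N ->
    (\sum_(j.+1 <= l < m) P (small_increment W rho (tau j) (tau l))
      <= G%:E)%E) ->
  forall k j n t, (j < m)%N -> t n = tau j -> 0 <= t 0%N ->
  (forall i, (i < n)%N -> t i < t i.+1) ->
  (\int[P]_(w in small_increments W rho n t)
     (chains rho (fun i => W (tau i) w) m k j)%:R%:E <=
   P (small_increments W rho n t) * (G ^+ k)%:E)%E.
Proof.
move=> bm G0 tauT taui sumG; elim => [|k IH] j n t jm tn t0 tinc.
  rewrite expr0 mule1 /= integral_cst ?mul1e//.
  exact: measurable_small_increments.
set A := small_increments W rho n t.
have mA : measurable A by exact: measurable_small_increments.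
pose D l := small_increment W rho (tau j) (tau l).
have mD l : measurable (D l) by exact: measurable_small_increment.
pose c l w := (chains rho (fun i => W (tau i) w) m k l)%:R : R.
have mc l : measurable_fun setT (c l) by exact: measurable_chains.
have -> : (\int[P]_(w in A) (chains rho (fun i => W (tau i) w) m k.+1 j)%:R%:E =
    \int[P]_(w in A) \sum_(j.+1 <= l < m) (\1_(D l) w * c l w)%:E)%E.
  by apply: eq_integral => w _; rewrite chainsS sumEFin; congr EFin.
rewrite ge0_integral_sum//; last 2 first.
- move=> l; apply/measurable_EFinP/measurable_funTS/measurable_funM => //.
- by move=> l w _; rewrite lee_fin mulr_ge0.
apply: (@le_trans _ _ (\sum_(j.+1 <= l < m) (P A * P (D l) * (G ^+ k)%:E))%E).
  rewrite big_nat_cond [leRHS]big_nat_cond.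
  apply: lee_sum => l /andP[/andP[jl lm] _].
  have tl : t n < tau l by rewrite tn taui// jl.
  have lT : tau l <= T by case/andP: (tauT l lm).
  pose t' i := if (i <= n)%N then t i else tau l.
  have ADE : small_increments W rho n.+1 t' = A `&` D l.
    apply/seteqP; split => w /=.
      move=> wA; split => [i ni|].
        by have := wA i (ltnW ni); rewrite /t' ni (ltnW ni).
      by have := wA n (leqnn _); rewrite /t' leqnn ltnn tn.
    move=> [wA wn] i; rewrite ltnS leq_eqVlt => /orP[/eqP ->|ni].
      by rewrite /t' leqnn ltnn tn.
    by rewrite /t' ni (ltnW ni); exact: wA.
  have -> : (P A * P (D l))%E = P (A `&` D l).
    by rewrite /A /D -tn (prob_small_increments rho bm).
  have -> : (\int[P]_(w in A) (\1_(D l) w * c l w)%:E =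
      \int[P]_(w in A `&` D l) (c l w)%:E)%E.
    rewrite integral_mkcondr; apply: eq_integral => w _.
    by rewrite epatch_indic EFinM muleC.
  rewrite -ADE; apply: IH => //.
  - by rewrite /t' ltnn.
  - move=> i; rewrite ltnS leq_eqVlt => /orP[/eqP ->|ni].
      by rewrite /t' leqnn ltnn.
    by rewrite /t' ni (ltnW ni) tinc.
rewrite exprS EFinM.
rewrite -ge0_sume_distrl; last by move=> l _; rewrite mule_ge0.
rewrite -ge0_sume_distrr//.
rewrite muleA lee_wpmul2r ?lee_fin ?exprn_ge0// lee_wpmul2l// .
exact: sumG.
Qed.

(** * Crowded cells are improbable *)

Lemma prob_many_chains d (Omega : measurableType d) (R : realType)
    (P : probability Omega R) (T : R) (W : R -> {RV P >-> R}) (rho : R)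
    (tau : nat -> R) (m : nat) (G : R) (k b : nat) :
  brownian_motion T W -> 0 <= G -> (0 < b)%N ->
  (forall j, (j < m)%N -> 0 <= tau j <= T) ->
  (forall i j, (i < j < m)%N -> tau i < tau j) ->
  (forall j, (j < m)%N ->
    (\sum_(j.+1 <= l < m) P (small_increment W rho (tau j) (tau l)) <= G%:E)%E) ->
  let E := [set w |
    (b <= \sum_(0 <= j < m) chains rho (fun i => W (tau i) w) m k j)%N] in
  measurable E /\ (P E <= (m%:R * G ^+ k / b%:R)%:E)%E.
Proof.
move=> bm G0 b0 tauT taui sumG E.
pose V w := \sum_(0 <= j < m) (chains rho (fun i => W (tau i) w) m k j)%:R : R.
have mV : measurable_fun setT V.
  by apply: measurable_sum => j; exact: measurable_chains.
have EE : E = V @^-1` `[b%:R, +oo[%classic.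
  by apply/seteqP; split => w; rewrite /E /V /= in_itv /= andbT -natr_sum ler_nat.
have mE : measurable E.
  by rewrite EE -[X in measurable X]setTI; apply: mV => //; exact: measurable_itv.
split=> //.
have V0 w : 0 <= V w by apply: sumr_ge0.
have intV : (\int[P]_w (V w)%:E <= (m%:R * G ^+ k)%:E)%E.
  under eq_integral do rewrite -sumEFin.
  rewrite ge0_integral_sum//; last first.
    by move=> j; apply/measurable_EFinP; exact: measurable_chains.
  apply: (@le_trans _ _ (\sum_(0 <= j < m) (G ^+ k)%:E)%E); last first.
    by rewrite sumEFin lee_fin sumr_const_nat subn0 mulr_natl.
  rewrite big_nat_cond [leRHS]big_nat_cond.
  apply: lee_sum => j /andP[/andP[_ jm] _].
  have := integral_chains_le bm G0 tauT taui sumG k (n := 0) (t := fun=> tau j) jm.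
  have -> : small_increments W rho 0 (fun=> tau j) = setT by apply/seteqP; split.
  rewrite probability_setT mul1e; apply => //.
  by case/andP: (tauT j jm).
rewrite EFinM lee_pdivlMr ?ltr0n// muleC.
apply: le_trans intV.
rewrite -integral_cst//.
apply: (@le_trans _ _ (\int[P]_(w in E) (V w)%:E)%E).
  apply: ge0_le_integral => //=.
  - by apply/measurable_EFinP/measurable_funTS.
  - by move=> w; rewrite EE /= in_itv /= andbT lee_fin.
apply: ge0_subset_integral => //=.
- exact/measurable_EFinP.
- by move=> w _; rewrite lee_fin.
Qed.

Lemma sum_inv_sqrt_le (R : realType) (n : nat) :
  \sum_(1 <= i < n.+1) (Num.sqrt i%:R)^-1 <= 2 * Num.sqrt n%:R :> R.
Proof.
elim: n => [|n IH]; first by rewrite big_nil mulr_ge0.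
rewrite big_nat_recr//=.
apply: (le_trans (lerD IH (lexx _))).
set a := Num.sqrt n%:R; set b := Num.sqrt n.+1%:R.
have a0 : 0 <= a by rewrite sqrtr_ge0.
have b0 : 0 < b by rewrite sqrtr_gt0 ltr0n.
have ab : a <= b by rewrite ler_sqrt ?ler0n// ler_nat.
have a2 : a ^+ 2 = n%:R by rewrite sqr_sqrtr ?ler0n.
have b2 : b ^+ 2 = n%:R + 1 by rewrite sqr_sqrtr ?ler0n// -natr1.
rewrite -lerBrDl -mulrBr -[leLHS]mul1r ler_pdivrMr//.
nra.
Qed.

Definition grid {R : realType} (T : R) (L e : nat) : R := T * e%:R / L%:R.

Lemma grid_itv {R : realType} (T : R) (L e : nat) : 0 <= T -> (e <= L)%N ->
  0 <= grid T L e <= T.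
Proof.
move=> T0 eL; have [->|L0] := posnP L; first by rewrite /grid invr0 mulr0 lexx.
rewrite /grid divr_ge0 ?mulr_ge0//= ler_pdivrMr ?ltr0n//.
by rewrite ler_wpM2l// ler_nat.
Qed.

Lemma grid_lt {R : realType} (T : R) (L i j : nat) : 0 < T -> (0 < L)%N ->
  (i < j)%N -> grid T L i < grid T L j.
Proof.
move=> T0 L0 ij.
by rewrite /grid ltr_pM2r ?invr_gt0 ?ltr0n// ltr_pM2l// ltr_nat.
Qed.

(** An interval of length [T / N ^ 10] is cut in [N ^ 20] cells; the
    typical number of cells near a given value at scale [1 / N ^ 10] is
    [N ^ 15], and the bound [N ^ 16] leaves a margin. *)
Definition uncrowded {R : realType} (T c : R) (w : R -> R) (N : nat) : Prop :=
  forall (i : nat) (a : R), (i < N ^ 10)%N ->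
  (count (fun j => `|w (grid T (N ^ 30) (i * N ^ 20 + j)) - a| <= c / N%:R ^+ 10)%R
     (iota 0 (N ^ 20)) <= N ^ 16)%N.

Definition crowd_chains {R : realType} (T c : R) (w : R -> R) (N k i : nat) : nat :=
  (\sum_(0 <= j < N ^ 20) chains (2 * c / N%:R ^+ 10)
    (fun j => w (grid T (N ^ 30) (i * N ^ 20 + j))) (N ^ 20) k j)%N.

Lemma few_chains_uncrowded {R : realType} (T c : R) (w : R -> R) (N k : nat) :
  (forall i, (i < N ^ 10)%N ->
    (crowd_chains T c w N k i < 'C(N ^ 16, k.+1))%N) ->
  uncrowded T c w N.
Proof.
move=> few i a iN; rewrite leqNgt; apply/negP => crowd.
have := few i iN; rewrite ltnNge => /negP; apply.
apply: leq_trans (leq_bin2l _ (ltnW crowd)) _.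
apply: bin_le_sum_chains => j l hj hl.
set x := w _; set y := w _.
have -> : x - y = (x - a) - (y - a) by ring.
apply: (le_trans (ler_normB _ _)).
have := lerD hj hl; lra.
Qed.

Lemma grid_sub {R : realType} (T : R) (L i j : nat) : (i <= j)%N ->
  grid T L j - grid T L i = T * (j - i)%:R / L%:R.
Proof. by move=> ij; rewrite /grid natrB// mulrBr mulrBl. Qed.

Lemma prob_small_increment_le d (Omega : measurableType d) (R : realType)
    (P : probability Omega R) (T : R) (W : R -> {RV P >-> R}) (rho s t : R) :
  brownian_motion T W -> 0 <= rho -> 0 <= s -> s < t -> t <= T ->
  (P (small_increment W rho s t) <= (2 * rho / Num.sqrt (t - s))%:E)%E.
Proof.
move=> bm rho0 s0 st tT.
have -> : small_increment W rho s t =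
  increment W s t @^-1` [set x : R | `|x| <= rho] by [].
rewrite (bm_gaussian bm)//; last exact: measurable_ball0.
by apply: normal_prob_ball => //; rewrite sqrtr_gt0 subr_gt0.
Qed.

(** Two grid times at distance [T d / N ^ 30] have values within
    [2 c / N ^ 10] with probability of order [N ^ 5 / sqrt d].  Summed over
    [d <= N ^ 20] this is of order [N ^ 15]. *)
Lemma prob_crowd_chains d (Omega : measurableType d) (R : realType)
    (P : probability Omega R) (T c : R) (W : R -> {RV P >-> R}) (N k i b : nat) :
  brownian_motion T W -> 0 < T -> 0 <= c -> (0 < N)%N -> (i < N ^ 10)%N -> (0 < b)%N ->
  let E := [set w | (b <= crowd_chains T c (fun t => W t w) N k i)%N] in
  measurable E /\
  (P E <= (N%:R ^+ 20 * (8 * c / Num.sqrt T * N%:R ^+ 15) ^+ k / b%:R)%:E)%E.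
Proof.
move=> bm T0 c0 N0 iN b0 E.
have N30 : (0 < N ^ 30)%N by rewrite expn_gt0 N0.
have NR0 : 0 < N%:R :> R by rewrite ltr0n.
pose tau j := grid T (N ^ 30) (i * N ^ 20 + j).
have tauT j : (j < N ^ 20)%N -> 0 <= tau j <= T.
  move=> jN; apply: grid_itv; first exact: ltW.
  rewrite [leqRHS](_ : _ = N ^ 10 * N ^ 20)%N; last by rewrite -expnD.
  apply: (@leq_trans (i.+1 * N ^ 20)); last by rewrite leq_mul2r iN orbT.
  by rewrite mulSn addnC leq_add2r ltnW.
have := @prob_many_chains _ _ _ _ T W (2 * c / N%:R ^+ 10) tau (N ^ 20)
  (8 * c / Num.sqrt T * N%:R ^+ 15) k b bm.
rewrite natrX; apply => //.
- by rewrite !mulr_ge0 ?invr_ge0 ?sqrtr_ge0 ?exprn_ge0.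
- by move=> j l /andP[jl lN]; apply: grid_lt => //; rewrite ltn_add2l.
move=> j jN.
apply: (@le_trans _ _ (\sum_(j.+1 <= l < N ^ 20)
   (4 * c / Num.sqrt T * N%:R ^+ 5 * (Num.sqrt (l - j)%:R)^-1)%:E)%E).
  rewrite big_nat_cond [leRHS]big_nat_cond.
  apply: lee_sum => l /andP[/andP[jl lN] _].
  have lj0 : 0 < (l - j)%:R :> R by rewrite ltr0n subn_gt0.
  apply: (le_trans (prob_small_increment_le bm _ _ _ _)).
  - by rewrite !mulr_ge0 ?invr_ge0 ?exprn_ge0.
  - by case/andP: (tauT j jN).
  - by apply: grid_lt => //; rewrite ltn_add2l.
  - by case/andP: (tauT l lN).
  rewrite lee_fin /tau grid_sub; last by rewrite leq_add2l ltnW.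
  rewrite subnDl natrX.
  have -> : Num.sqrt (T * (l - j)%:R / N%:R ^+ 30) =
      Num.sqrt T * Num.sqrt (l - j)%:R / N%:R ^+ 15.
    rewrite sqrtrM ?mulr_ge0 ?(ltW T0)// sqrtrM ?(ltW T0)//; congr (_ * _).
    by rewrite (_ : 30 = 15 * 2)%N// exprM -exprVn sqrtr_sqr ger0_norm// invr_ge0 exprn_ge0.
  rewrite le_eqVlt; apply/orP; left; apply/eqP; field; rewrite ?gt_eqF ?sqrtr_gt0 //.
rewrite sumEFin lee_fin -mulr_sumr.
have -> : \sum_(j.+1 <= l < N ^ 20) (Num.sqrt (l - j)%:R)^-1 =
    \sum_(1 <= l < N ^ 20 - j) (Num.sqrt l%:R)^-1 :> R.
  by rewrite -[j.+1]add1n big_addn; apply: eq_bigr => l _; rewrite addnK.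
have -> : (N ^ 20 - j = (N ^ 20 - j.+1).+1)%N by lia.
apply: (@le_trans _ _ (4 * c / Num.sqrt T * N%:R ^+ 5 * (2 * N%:R ^+ 10))).
  apply: ler_wpM2l; first by rewrite !mulr_ge0 ?invr_ge0 ?sqrtr_ge0 ?exprn_ge0.
  apply: (le_trans (sum_inv_sqrt_le _ _)); rewrite ler_pM2l//.
  have -> : N%:R ^+ 10 = Num.sqrt (N%:R ^+ 20) :> R.
    by rewrite (_ : 20 = 10 * 2)%N// exprM sqrtr_sqr ger0_norm// exprn_ge0.
  rewrite ler_sqrt ?exprn_ge0// -natrX ler_nat; lia.
by rewrite le_eqVlt; apply/orP; left; apply/eqP; field; rewrite gt_eqF// sqrtr_gt0.
Qed.

(** With chains of [k + 1] times, the union over the [N ^ 10] intervals has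
    probability of order [N ^ (10 + 20 + 15 k - 16 (k + 1))], which is [1 / N]
    for [k = 15]. *)
Lemma ae_uncrowded d (Omega : measurableType d) (R : realType)
    (P : probability Omega R) (T c : R) (W : R -> {RV P >-> R}) :
  brownian_motion T W -> 0 < T -> 0 <= c ->
  {ae P, forall w, exists n0, forall n, (n0 <= n)%N ->
     uncrowded T c (fun t => W t w) (2 ^ n)}.
Proof.
move=> bm T0 c0.
(* [k] is kept abstract to prevent the evaluation of large numbers. *)
have [k k15] : exists k, k = 15%N by exists 15%N.
pose b n := 'C((2 ^ n) ^ 16, k.+1).
pose E n i := [set w | (b n <= crowd_chains T c (fun t => W t w) (2 ^ n) k i)%N].
pose F n := \bigcup_(i < (2 ^ n) ^ 10) E n i.
pose K := (2 ^ k.+1 * k.+1`!)%N.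
pose C1 := 8 * c / Num.sqrt T.
have C10 : 0 <= C1 by rewrite !mulr_ge0 ?invr_ge0 ?sqrtr_ge0.
have bK n : (0 < n)%N -> (((2 ^ n) ^ 16) ^ k.+1 <= K * b n)%N.
  move=> n0; apply: expn_le_bin; rewrite k15 -expnM.
  by rewrite (_ : 2 * 16 = 2 ^ 5)%N// leq_exp2l//; lia.
have b0 n : (0 < n)%N -> (0 < b n)%N.
  move=> n0; rewrite lt0n; apply/eqP => bn0; have := bK n n0.
  by rewrite bn0 muln0 leqn0 !expn_eq0.
have mE n i : (0 < n)%N -> (i < (2 ^ n) ^ 10)%N -> measurable (E n i).
  move=> n0 iN; have N0 : (0 < 2 ^ n)%N by rewrite expn_gt0.
  by have [] := prob_crowd_chains k bm T0 c0 N0 iN (b0 n n0).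
have mF : forall n, (1 <= n)%N -> measurable (F n).
  by move=> n n0; apply: bigcup_measurable => i /= iN; exact: mE.
have PF n : (0 < n)%N -> (P (F n) <= ((C1 ^+ k * K%:R) * 2^-1 ^+ n)%:E)%E.
  move=> n0; rewrite /F.
  have N0 : (0 < 2 ^ n)%N by rewrite expn_gt0.
  set N := (2 ^ n)%N in N0 *.
  have NR0 : 0 < N%:R :> R by rewrite ltr0n.
  apply: (@le_trans _ _ (\sum_(i < N ^ 10) P (E n i))%E).
    rewrite bigcup_mkord; apply: Boole_inequality => i iN; exact: mE.
  apply: (@le_trans _ _ (\sum_(i < N ^ 10)
      (N%:R ^+ 20 * (C1 * N%:R ^+ 15) ^+ k / (b n)%:R)%:E)%E).
    apply: lee_sum => i _.
    by have [] := prob_crowd_chains k bm T0 c0 N0 (ltn_ord i) (b0 n n0).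
  rewrite sumEFin lee_fin sumr_const card_ord -[leLHS]mulr_natl.
  have -> : 2^-1 ^+ n = N%:R^-1 :> R by rewrite /N natrX exprVn.
  rewrite (natrX _ N 10) [leLHS]mulrA ler_pdivrMr ?ltr0n ?b0//.
  rewrite [leRHS]mulrAC ler_pdivlMr//.
  apply: (@le_trans _ _ (C1 ^+ k * (N%:R ^+ 16) ^+ k.+1)).
    rewrite exprMn k15; rewrite le_eqVlt; apply/orP; left; apply/eqP; ring.
  rewrite -mulrA ler_wpM2l ?exprn_ge0//.
  by rewrite -!natrX -natrM ler_nat bK.
apply: filterS (ae_eventually mF PF) => w [n0 H].
exists (maxn n0 1) => n; rewrite geq_max => /andP[n0n n1].
apply: (@few_chains_uncrowded _ _ _ _ _ k) => i iN.
rewrite ltnNge; apply/negP => h; apply: (H n n0n); exists i => //.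
Qed.

(** * A Hoelder bound on the grids of base 8 *)

(** Hoelder continuity of exponent 1/3 for neighbouring points of the grid of
    step [T / 8 ^ k], since [2 ^ k] is the cube root of [8 ^ k]. *)
Definition holder_grid {R : realType} (T : R) (w : R -> R) (k : nat) : Prop :=
  forall j, (j < 8 ^ k)%N ->
  `|w (grid T (8 ^ k) j.+1) - w (grid T (8 ^ k) j)| <= 2^-1 ^+ k.

Lemma expRN_le (R : realType) (z : R) : 0 < z -> expR (- z) <= 256 / z ^+ 4.
Proof.
move=> z0; rewrite expRN -invf_div lef_pV2 ?posrE ?expR_gt0 ?divr_gt0 ?exprn_gt0//.
have -> : expR z = expR (z / 4) ^+ 4 by rewrite -expRM_natl; congr expR; field.
have h : z / 4 <= expR (z / 4) by apply: le_trans (expR_ge1Dx _); lra.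
have -> : z ^+ 4 / 256 = (z / 4) ^+ 4 by field.
by rewrite ler_pXn2r // ?nnegrE ?expR_ge0 // divr_ge0 // ltW.
Qed.

Lemma ae_holder_grid d (Omega : measurableType d) (R : realType)
    (P : probability Omega R) (T : R) (W : R -> {RV P >-> R}) :
  brownian_motion T W -> 0 < T ->
  {ae P, forall w, exists k0, forall k, (k0 <= k)%N ->
     holder_grid T (fun t => W t w) k}.
Proof.
move=> bm T0.
pose E k j := ~` small_increment W (2^-1 ^+ k)
  (grid T (8 ^ k) j) (grid T (8 ^ k) j.+1).
pose F k := \big[setU/set0]_(j < 8 ^ k) E k j.
have mE k j : measurable (E k j).
  by apply: measurableC; exact: measurable_small_increment.
have mF k : (0 <= k)%N -> measurable (F k) by move=> _; exact: bigsetU_measurable.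
have PE k j : (j < 8 ^ k)%N -> (P (E k j) <= (2 * (256 * (4 * T) ^+ 4) / 16 ^+ k)%:E)%E.
  move=> jk; have k8 : (0 < 8 ^ k)%N by rewrite expn_gt0.
  have k8R : 0 < (8 ^+ k) :> R by rewrite exprn_gt0.
  have -> : E k j = increment W (grid T (8 ^ k) j) (grid T (8 ^ k) j.+1) @^-1`
      [set x : R | 2^-1 ^+ k < `|x|].
    apply/seteqP; split => w; rewrite /E /small_increment /=.
      by move/negP; rewrite -ltNge.
    by rewrite ltNge => /negP.
  have [g0 _] := andP (grid_itv (ltW T0) (ltnW jk)).
  have [_ gT] := andP (grid_itv (ltW T0) jk).
  rewrite (bm_gaussian bm) ?grid_lt//; last first.
    rewrite (_ : mkset _ = ~` [set x : R | `|x| <= 2^-1 ^+ k]).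
      by apply: measurableC; exact: measurable_ball0.
    apply/seteqP; split => x /=.
      by rewrite ltNge => /negP.
    by move/negP; rewrite -ltNge.
  rewrite grid_sub// subSnn mulr1 natrX.
  apply: (le_trans (normal_prob_tail _ _)); rewrite ?sqrtr_gt0 ?divr_gt0 ?exprn_ge0//.
  rewrite lee_fin sqr_sqrtr ?divr_ge0 ?(ltW T0) ?(ltW k8R)//.
  have -> : (2^-1 ^+ k) ^+ 2 / (4 * (T / 8 ^+ k)) = 2 ^+ k / (4 * T) :> R.
    have -> : 8 ^+ k = (2 ^+ k) ^+ 3 :> R by rewrite -exprM mulnC exprM; congr (_ ^+ _); ring.
    by rewrite exprVn; field; rewrite expf_neq0// gt_eqF.
  rewrite -!mulrA ler_pM2l//.
  apply: (le_trans (expRN_le _)); first by rewrite divr_gt0 ?exprn_gt0// mulr_gt0.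
  have -> : 16 ^+ k = (2 ^+ k) ^+ 4 :> R by rewrite -exprM mulnC exprM; congr (_ ^+ _); ring.
  rewrite le_eqVlt; apply/orP; left; apply/eqP; field.
  by rewrite expf_neq0// gt_eqF.
have PF k : (0 <= k)%N -> (P (F k) <= ((2 * (256 * (4 * T) ^+ 4)) * 2^-1 ^+ k)%:E)%E.
  move=> _; apply: (le_trans (Boole_inequality P _)) => //.
  apply: (@le_trans _ _ (\sum_(j < 8 ^ k) (2 * (256 * (4 * T) ^+ 4) / 16 ^+ k)%:E)%E).
    by apply: lee_sum => j _; exact: PE.
  rewrite sumEFin lee_fin sumr_const card_ord -[leLHS]mulr_natl natrX.
  have -> : 16 ^+ k = 8 ^+ k * 2 ^+ k :> R by rewrite -exprMn; congr (_ ^+ _); ring.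
  rewrite exprVn le_eqVlt; apply/orP; left; apply/eqP; field.
  by rewrite !expf_neq0.
apply: filterS (ae_eventually mF PF) => w [k0 H].
exists k0 => k k0k j jk; rewrite leNgt; apply/negP => h; apply: (H k k0k).
rewrite /F -bigcup_mkord; exists j => //=.
by rewrite /E /small_increment /= => h'; move: h; rewrite ltNge => /negP; apply.
Qed.

(** * Cells in which the sum with a Lipschitz function is small *)

Definition cell {R : realType} (T : R) (L : nat) (s : R) : nat :=
  Num.truncn (s * L%:R / T).

Lemma cellP {R : realType} (T : R) (L e : nat) (s : R) : 0 < T -> (0 < L)%N ->
  0 <= s -> (cell T L s == e) = (grid T L e <= s < grid T L e.+1).
Proof.
move=> T0 L0 s0; have L0R : 0 < L%:R :> R by rewrite ltr0n.
rewrite /cell truncn_eq ?divr_ge0 ?mulr_ge0 ?(ltW T0)//.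
rewrite /grid ler_pdivlMr// ltr_pdivrMr// ler_pdivrMr// ltr_pdivlMr//.
by rewrite (mulrC _ T) (mulrC _ T).
Qed.

Lemma cell_itv {R : realType} (T : R) (L : nat) (s : R) : 0 < T -> (0 < L)%N ->
  0 <= s -> grid T L (cell T L s) <= s < grid T L (cell T L s).+1.
Proof. by move=> T0 L0 s0; rewrite -cellP. Qed.

Lemma grid_mul {R : realType} (T : R) (L B a : nat) : (0 < L)%N -> (0 < B)%N ->
  grid T (L * B) (a * B) = grid T L a.
Proof.
move=> L0 B0; rewrite /grid !natrM; field.
by rewrite !pnatr_eq0 -!lt0n L0.
Qed.

Lemma grid_le {R : realType} (T : R) (L i j : nat) : 0 <= T ->
  (i <= j)%N -> grid T L i <= grid T L j.
Proof.
by move=> T0 ij; rewrite /grid ler_wpM2r ?invr_ge0// ler_wpM2l// ler_nat.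
Qed.

Lemma cell_div {R : realType} (T : R) (L B : nat) (s : R) : 0 < T -> (0 < L)%N ->
  (0 < B)%N -> 0 <= s -> cell T L s = (cell T (L * B) s %/ B)%N.
Proof.
move=> T0 L0 B0 s0; apply/eqP; rewrite cellP//.
have LB0 : (0 < L * B)%N by rewrite muln_gt0 L0.
have /andP[h1 h2] := cell_itv T0 LB0 s0.
set e := cell _ _ _ in h1 h2 *.
rewrite -(grid_mul T _ L0 B0) -(grid_mul T _.+1 L0 B0).
rewrite (le_trans _ h1)/=; last by apply: grid_le; [exact: ltW|exact: leq_trunc_div].
apply: (lt_le_trans h2); apply: grid_le; first exact: ltW.
by rewrite ltn_ceil.
Qed.

Lemma cell_lt {R : realType} (T : R) (L : nat) (s : R) : 0 < T -> (0 < L)%N ->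
  0 <= s < T -> (cell T L s < L)%N.
Proof.
move=> T0 L0 /andP[s0 sT]; rewrite ltnNge; apply/negP => h.
have /andP[h1 _] := cell_itv T0 L0 s0.
have TE : grid T L L = T by rewrite /grid mulfK// pnatr_eq0 -lt0n.
have := grid_le L (ltW T0) h; rewrite TE => h2.
by have := lt_le_trans sT (le_trans h2 h1); rewrite ltxx.
Qed.

Lemma cell_dist {R : realType} (T : R) (L : nat) (s : R) : 0 < T -> (0 < L)%N ->
  0 <= s -> `|s - grid T L (cell T L s)| <= T / L%:R.
Proof.
move=> T0 L0 s0; have /andP[h1 h2] := cell_itv T0 L0 s0.
rewrite ger0_norm ?subr_ge0//.
have := grid_sub T L (leqnSn (cell T L s)); rewrite subSnn mulr1 => <-.
by rewrite lerD2r ltW.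
Qed.

(** Between two successive base 8 approximations of [s] there are at most 7
    grid steps, and the bounds for these steps are summed. *)
Lemma holder_chain {R : realType} (T : R) (w : R -> R) (k0 k n : nat) (s : R) :
  0 < T -> (forall k, (k0 <= k)%N -> holder_grid T w k) -> (k0 <= k)%N ->
  0 <= s < T ->
  `|w (grid T (8 ^ (k + n)) (cell T (8 ^ (k + n)) s)) -
    w (grid T (8 ^ k) (cell T (8 ^ k) s))| <= 7 * (2^-1 ^+ k - 2^-1 ^+ (k + n)).
Proof.
move=> T0 H k0k s0T; have /andP[s0 sT] := s0T.
elim: n => [|n IH]; first by rewrite addn0 !subrr normr0 mulr0.
have p8 m : (0 < 8 ^ m)%N by rewrite expn_gt0.
set m := (k + n)%N in IH *.
rewrite addnS -/m.
set g := fun m => grid T (8 ^ m) (cell T (8 ^ m) s).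
have : `|w (g m.+1) - w (g m)| <= 7 * 2^-1 ^+ m.+1.
  have cE := cell_div T0 (p8 m) (isT : (0 < 8)%N) s0.
  rewrite -expnSr in cE.
  set e := cell T (8 ^ m.+1) s in cE.
  have e8 : (e < 8 ^ m.+1)%N by exact: cell_lt.
  have gE : g m = grid T (8 ^ m.+1) (e %/ 8 * 8).
    by rewrite /g cE expnSr grid_mul.
  have dE d : (e %/ 8 * 8 + d <= e)%N ->
      `|w (grid T (8 ^ m.+1) (e %/ 8 * 8 + d)) - w (g m)| <= d%:R * 2^-1 ^+ m.+1.
    elim: d => [|d IHd] hd; first by rewrite addn0 gE subrr normr0 mul0r.
    have {}IHd := IHd (ltac:(lia)).
    have := H m.+1 (ltac:(rewrite /m; lia)) (e %/ 8 * 8 + d)%N (ltac:(lia)).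
    rewrite -addnS => h.
    rewrite -natr1 mulrDl mul1r.
    set x := w _ in h *; set y := w _ in h *.
    have -> : x - w (g m) = (y - w (g m)) + (x - y) by ring.
    by apply: (le_trans (ler_normD _ _)); exact: lerD.
  have := dE (e %% 8)%N; rewrite -divn_eq => /(_ (leqnn _)) h.
  rewrite {1}/g -/e; apply: (le_trans h).
  by rewrite ler_wpM2r ?exprn_ge0// ler_nat -ltnS ltn_mod.
move=> h; rewrite -/(g m) in IH *.
have -> : w (g m.+1) - w (g k) = (w (g m.+1) - w (g m)) + (w (g m) - w (g k)) by ring.
apply: (le_trans (ler_normD _ _)); apply: (le_trans (lerD h IH)).
by rewrite exprS; lra.
Qed.

Lemma within_continuous_eps {R : realType} (a b : R) (f : R -> R) (s e : R) :
  {within `[a, b], continuous f} -> s \in `[a, b] -> 0 < e ->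
  exists2 d : R, 0 < d &
    forall u, u \in `[a, b] -> `|s - u| < d -> `|f s - f u| < e.
Proof.
move=> /subspace_continuousP cf sab e0.
have := cf s sab; move/cvgrPdist_lt => /(_ e e0).
rewrite near_withinE => /nbhs_ballP[d /= d0 H]; exists d => // u uab su.
exact: H.
Qed.

Lemma exists_expr_lt {R : realType} (d : R) : 0 < d -> exists n, 2^-1 ^+ n < d.
Proof.
move=> d0; exists (Num.truncn d^-1).+1.
rewrite exprVn -[ltRHS]invrK ltf_pV2 ?posrE ?invr_gt0 ?exprn_gt0//.
apply: (lt_trans (truncnS_gt _)).
by rewrite -natrX ltr_nat ltn_expl.
Qed.

Lemma holder_cell {R : realType} (T : R) (w : R -> R) (k0 k : nat) (s : R) :
  0 < T -> (forall k, (k0 <= k)%N -> holder_grid T w k) ->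
  {within `[0, T], continuous w} -> (k0 <= k)%N ->
  0 <= s < T ->
  `|w s - w (grid T (8 ^ k) (cell T (8 ^ k) s))| <= 7 * 2^-1 ^+ k.
Proof.
move=> T0 H cw k0k s0T; have /andP[s0 sT] := s0T.
apply/ler_addgt0Pr => e e0.
have sI : s \in `[0, T] by rewrite in_itv /= s0 ltW.
have [d d0 dw] := within_continuous_eps cw sI e0.
have [n nd] := exists_expr_lt (divr_gt0 d0 T0).
have L0 : (0 < 8 ^ (k + n))%N by rewrite expn_gt0.
have cL := cell_lt T0 L0 s0T.
set g := grid T _ _.
set g' := grid T (8 ^ (k + n)) (cell T (8 ^ (k + n)) s).
have g'I : g' \in `[0, T] by rewrite in_itv /=; apply: grid_itv; [exact: ltW|exact: ltnW].
have sg' : `|s - g'| < d.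
  apply: (le_lt_trans (cell_dist T0 L0 s0)).
  rewrite mulrC -ltr_pdivlMr//; apply: le_lt_trans nd.
  rewrite exprVn lef_pV2 ?posrE ?ltr0n ?exprn_gt0// -natrX ler_nat.
  by rewrite (_ : 8 = 2 ^ 3)%N// -expnM leq_exp2l//; lia.
have := dw _ g'I sg'.
have := holder_chain n T0 H k0k s0T; rewrite -/g -/g' => h1 h2.
have -> : w s - w g = (w s - w g') + (w g' - w g) by ring.
apply: (le_trans (ler_normD _ _)).
have : 0 <= 2^-1 ^+ (k + n) :> R by rewrite exprn_ge0.
lra.
Qed.

(** Cells are half-open, so that each time before [T] lies in exactly one cell
    of each grid and the cells of a finer grid refine those of a coarser one. *)
Definition visits {R : realType} (T r : R) (X : R -> R) (L e : nat) : bool :=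
  `[< exists s, [/\ 0 <= s < T, cell T L s = e & `|X s| <= r] >].

Definition nvisits {R : realType} (T r : R) (X : R -> R) (L : nat) : nat :=
  count (visits T r X L) (iota 0 L).

Lemma count_refine (v1 v2 : pred nat) (A B M : nat) : (0 < B)%N ->
  (forall e, (e < A * B)%N -> v2 e -> v1 (e %/ B)%N) ->
  (forall a, (a < A)%N -> v1 a ->
     (count (fun b => v2 (a * B + b)) (iota 0 B) <= M)%N) ->
  (count v2 (iota 0 (A * B)) <= count v1 (iota 0 A) * M)%N.
Proof.
move=> B0; elim: A => [//|A IH] v21 v1M.
rewrite mulSnr iotaD count_cat -[A.+1]addn1 iotaD count_cat mulnDl.
apply: leq_add.
  apply: IH => [e eA|a aA]; [apply: v21; rewrite mulSnr; lia|apply: v1M; lia].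
rewrite !add0n /= addn0 -[X in iota X B]addn0 iotaDl count_map.
have [v1A|nv1A] := boolP (v1 A); first by rewrite mul1n; exact: v1M.
rewrite mul0n leqn0 -/(is_true _) eqn0Ngt -has_count; apply/hasPn => b.
rewrite mem_iota add0n => /= bB; apply: contra nv1A => v2b.
have := v21 (A * B + b)%N (ltac:(rewrite mulSnr; lia)) v2b.
by rewrite divnMDl// divn_small// addn0.
Qed.

Definition lipschitz_on {R : realType} (T K : R) (y : R -> R) : Prop :=
  forall s t, 0 <= s <= T -> 0 <= t <= T -> `|y t - y s| <= K * `|t - s|.

(** One zoom: a visited cell of the fine grid lies in a visited cell of the
    coarse one, on which [y] is nearly constant, and there the absence of
    crowding limits the number of visited fine cells. *)
Lemma nvisits_refine {R : realType} (T K r c : R) (w y : R -> R) (N : nat) :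
  0 < T -> 0 <= K -> (0 < N)%N -> lipschitz_on T K y ->
  (forall s, 0 <= s < T ->
    `|w s - w (grid T (N ^ 30) (cell T (N ^ 30) s))| <= 7 / N%:R ^+ 10) ->
  uncrowded T c w N -> 8 + K * T <= c -> r <= 1 / N%:R ^+ 10 ->
  (nvisits T r (fun s => (w s + y s)%R) (N ^ 30) <=
   nvisits T r (fun s => (w s + y s)%R) (N ^ 10) * N ^ 16)%N.
Proof.
move=> T0 K0 N0 lip holder unc cK rN.
have NR0 : 0 < N%:R ^+ 10 :> R by rewrite exprn_gt0// ltr0n.
have E30 : (N ^ 30 = N ^ 10 * N ^ 20)%N by rewrite -expnD.
have N10 : (0 < N ^ 10)%N by rewrite expn_gt0 N0.
have N20 : (0 < N ^ 20)%N by rewrite expn_gt0 N0.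
have N30 : (0 < N ^ 30)%N by rewrite expn_gt0 N0.
rewrite /nvisits [X in iota 0 X](_ : _ = N ^ 10 * N ^ 20)%N//.
apply: count_refine => //.
  move=> e _ /asboolP[s [s0T <- Xs]]; apply/asboolP; exists s; split => //.
  by rewrite E30 -cell_div//; case/andP: s0T.
move=> i iN _.
apply: leq_trans (unc i (- y (grid T (N ^ 10) i)) iN).
rewrite -!size_filter; apply: uniq_leq_size; first by rewrite filter_uniq// iota_uniq.
move=> j; rewrite !mem_filter => /andP[/asboolP[s [s0T cs Xs]] jN]; rewrite jN andbT.
have /andP[s0 sT] := s0T.
have ci : cell T (N ^ 10) s = i.
  rewrite (cell_div T0 N10 N20 s0) -E30 cs divnMDl// divn_small ?addn0//.
  by move: jN; rewrite mem_iota add0n => /andP[].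
have := holder s s0T; rewrite cs.
have gI : 0 <= grid T (N ^ 10) i <= T by apply: grid_itv; [exact: ltW|exact: ltnW].
have := lip _ s gI; rewrite s0 (ltW sT) => /(_ isT).
have := cell_dist T0 N10 s0; rewrite ci natrX.
set g := grid T (N ^ 10) i; set wg := w (grid T (N ^ 30) _) => h1 h2 h3.
rewrite opprK.
have -> : wg + y g = - (w s - wg) + (w s + y s) + - (y s - y g) by ring.
have h4 : `|y s - y g| <= K * T / N%:R ^+ 10.
  by apply: (le_trans h2); rewrite -mulrA ler_wpM2l.
apply: (le_trans (ler_normD _ _)); rewrite normrN.
apply: (le_trans (lerD (ler_normD _ _) (lexx _))); rewrite normrN.
apply: (@le_trans _ _ ((7 + 1 + K * T) / N%:R ^+ 10)).
  by rewrite (mulrDl (7 + 1)) (mulrDl 7 1); apply: lerD => //; apply: lerD => //; exact: le_trans rN.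
by rewrite ler_pM2r ?invr_gt0//; lra.
Qed.

(** Two zooms, from step [N ^ 10] to [N ^ 30] with [N = 2 ^ n], then to
    [N ^ 90] with [N ^ 3] in the role of [N]. *)
Lemma nvisits_le {R : realType} (T K c : R) (w y : R -> R) (k0 n0 : nat) :
  0 < T -> 0 <= K -> lipschitz_on T K y ->
  (forall k, (k0 <= k)%N -> holder_grid T w k) ->
  {within `[0, T], continuous w} ->
  (forall n, (n0 <= n)%N -> uncrowded T c w (2 ^ n)) -> 8 + K * T <= c ->
  forall n, (maxn k0 n0 <= n)%N ->
  (nvisits T (2^-1 ^+ (30 * n)) (fun s => (w s + y s)%R) ((2 ^ n) ^ 90) <=
   (2 ^ n) ^ 74)%N.
Proof.
move=> T0 K0 lip H cw unc cK n; rewrite geq_max => /andP[k0n n0n].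
have refine m r : (n <= m)%N -> r <= 2^-1 ^+ (10 * m) ->
  (nvisits T r (fun s => (w s + y s)%R) ((2 ^ m) ^ 30) <=
   nvisits T r (fun s => (w s + y s)%R) ((2 ^ m) ^ 10) * (2 ^ m) ^ 16)%N.
  move=> nm rm.
  have E10 : 2^-1 ^+ (10 * m) = ((2 ^ m)%:R ^+ 10)^-1 :> R.
    by rewrite natrX -exprM -exprVn mulnC.
  apply: (nvisits_refine T0 K0 _ lip _ _ cK); rewrite ?expn_gt0//.
  - move=> s s0T; have := holder_cell T0 H cw (_ : k0 <= 10 * m)%N s0T.
    rewrite E10 (_ : 8 ^ (10 * m) = (2 ^ m) ^ 30)%N; last first.
      by rewrite -expnM (_ : 8 = 2 ^ 3)%N// -expnM; congr (2 ^ _)%N; lia.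
    by apply; lia.
  - by apply: unc; lia.
  - by rewrite mul1r -E10.
set r := _ ^+ _.
have r30 : r <= 2^-1 ^+ (10 * (3 * n)) by rewrite mulnA.
have r10 : r <= 2^-1 ^+ (10 * n).
  rewrite /r (_ : 30 * n = 10 * n + 20 * n)%N; last by lia.
  by rewrite exprD ler_piMr ?exprn_ge0// exprn_ile1//; lra.
have := refine (3 * n)%N r (ltac:(lia)) r30.
have := refine n r (leqnn n) r10.
rewrite (_ : 2 ^ (3 * n) = (2 ^ n) ^ 3)%N; last by rewrite -expnM mulnC.
rewrite -!(expnM (2 ^ n)) !mulSn !mul0n.
set N := (2 ^ n)%N => h1 h2; apply: (leq_trans h2).
have h0 : (nvisits T r (fun s => (w s + y s)%R) (N ^ 10) <= N ^ 10)%N.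
  by rewrite -{2}(size_iota 0 (N ^ 10)) count_size.
have h3 := leq_mul h1 (leqnn (N ^ 48)).
apply: (leq_trans h3); apply: leq_trans (leq_mul (leq_mul h0 (leqnn _)) (leqnn _)) _.
by rewrite -!expnD.
Qed.

Lemma measure_visits_le {R : realType} (T r : R) (X : R -> R) (L : nat)
    (A : set R) : 0 < T -> (0 < L)%N -> measurable A ->
  A `<=` [set s | s \in `[0, T] /\ `|X s| <= r] ->
  (lebesgue_measure A <= ((nvisits T r X L)%:R * T / L%:R)%:E)%E.
Proof.
move=> T0 L0 mA AX.
(* The cells are half-open, so [T] itself is covered separately. *)
pose B e := if visits T r X L e then `[grid T L e, grid T L e.+1[%classic else set0.
have mB e : measurable (B e : set R).
  by rewrite /B; case: ifP => _; [exact: measurable_itv|exact: measurable0].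
pose B' e := if (e < L)%N then B e else [set T].
have mB' e : measurable (B' e : set R).
  by rewrite /B'; case: ifP => _; [exact: mB|exact: measurable_set1].
apply: (@le_trans _ _ (\sum_(e < L.+1) lebesgue_measure (B' e))%E).
  apply: (content_subadditive lebesgue_measure); [by move=> ? _; exact: mB'|exact: mA|].
  move=> s /AX /= [sT Xs].
  have /andP[s0] : 0 <= s <= T by rewrite in_itv /= in sT.
  rewrite -bigcup_mkord le_eqVlt => /predU1P[->|sltT].
    by exists L => /=; rewrite ?ltnSn// /B' ltnn.
  have s0T : 0 <= s < T by rewrite s0.
  exists (cell T L s) => /=; first exact: ltnW (cell_lt T0 L0 s0T).
  rewrite /B' (cell_lt T0 L0 s0T) /B ifT; last first.
    by apply/asboolP; exists s.
  by rewrite /= in_itv /= cell_itv.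
rewrite big_ord_recr /= {2}/B' ltnn lebesgue_measure_set1 adde0.
rewrite (eq_bigr (fun e : 'I_L => ((visits T r X L e)%:R * (T / L%:R))%:E)).
  rewrite sumEFin lee_fin -mulr_suml -mulrA ler_wpM2r ?divr_ge0 ?(ltW T0)//.
  rewrite -natr_sum ler_nat /nvisits -sum1_count.
  rewrite -(big_mkord xpredT (fun e => (visits T r X L e : nat))) /index_iota subn0.
  by rewrite [leqRHS]big_mkcond; apply: leq_sum => e _; case: visits.
move=> e _; rewrite /B' ltn_ord /B; case: visits; last first.
  by rewrite measure0 mul0r.
rewrite lebesgue_measure_itv /= lte_fin grid_lt// -EFinD grid_sub// subSnn.
by rewrite mulr1 mul1r.
Qed.

(** * Integrability of the inverse square root *)

(** This holds for all Lipschitz functions simultaneously; it is the only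
    property of Brownian paths, besides continuity, on which the rest relies.  The
    exponents satisfy [16 / 30 > 1 / 2]. *)
Definition sparse_near_zero {R : realType} (T : R) (w : R -> R) : Prop :=
  forall (K : R) (y : R -> R), 0 <= K -> lipschitz_on T K y ->
  exists n1, forall n (A : set R), (n1 <= n)%N -> measurable A ->
  A `<=` [set s | s \in `[0, T] /\ `|w s + y s| <= 2^-1 ^+ (30 * n)] ->
  (lebesgue_measure A <= (T * 2^-1 ^+ (16 * n))%:E)%E.

Lemma ae_sparse_near_zero d (Omega : measurableType d) (R : realType)
    (P : probability Omega R) (T : R) (W : R -> {RV P >-> R}) :
  brownian_motion T W -> 0 < T ->
  {ae P, forall w, sparse_near_zero T (fun t => W t w)}.
Proof.
move=> bm T0.
have unc : {ae P, forall w, forall m : nat, exists n0, forall n, (n0 <= n)%N ->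
    uncrowded T m%:R (fun t => W t w) (2 ^ n)}.
  by apply/ae_foralln => m; exact: ae_uncrowded.
have hol := ae_holder_grid bm T0.
apply: filterS3 unc hol (bm_continuous bm) => w unc [k0 hol] cw.
move=> K y K0 lip.
have [n0 uncn] := unc (Num.truncn (8 + K * T)).+1.
(* 8 + K T: Hoelder bound 7 within a cell, radius 1, oscillation K T of [y]. *)
have cK : 8 + K * T <= (Num.truncn (8 + K * T)).+1%:R by exact/ltW/truncnS_gt.
exists (maxn k0 n0) => n A n1 mA AX.
have N0 : (0 < (2 ^ n) ^ 90)%N by rewrite !expn_gt0.
apply: (le_trans (measure_visits_le T0 N0 mA AX)).
rewrite lee_fin.
have := nvisits_le T0 K0 lip hol cw uncn cK n1.
rewrite -(ler_nat R) => h.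
have -> : 2^-1 ^+ (16 * n) = (((2 ^ n) ^ 16)%N%:R)^-1 :> R.
  by rewrite -expnM mulnC natrX exprVn.
set v := nvisits _ _ _ _.
have {}h : v%:R <= ((2 ^ n) ^ 74)%N%:R :> R by exact: h.
have -> : ((2 ^ n) ^ 90 = (2 ^ n) ^ 74 * (2 ^ n) ^ 16)%N by rewrite -expnD.
have p m : 0 < ((2 ^ n) ^ m)%N%:R :> R by rewrite ltr0n !expn_gt0.
rewrite natrM invfM; set a := ((2 ^ n) ^ 74)%N%:R^-1; set b := ((2 ^ n) ^ 16)%N%:R^-1.
have -> : v%:R * T * (a * b) = T * (v%:R * a) * b by ring.
rewrite ler_wpM2r ?invr_ge0 ?ler0n// ler_piMr ?(ltW T0)//.
by rewrite /a ler_pdivrMr// mul1r.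
Qed.

Lemma sparse_null {R : realType} (T K : R) (w y : R -> R) (A : set R) :
  sparse_near_zero T w -> 0 <= K -> lipschitz_on T K y -> measurable A ->
  A `<=` [set s | s \in `[0, T] /\ w s + y s = 0] ->
  lebesgue_measure A = 0%E.
Proof.
move=> sp K0 lip mA AX; have [n1 H] := sp K y K0 lip.
apply/eqP; rewrite -measure_le0.
apply/lee_addgt0Pr => e e0; rewrite add0e.
have [n nd] := exists_expr_lt (divr_gt0 e0 (ltr_wpDl (normr_ge0 T) ltr01)).
apply: (le_trans (H (n1 + n)%N A (leq_addr _ _) mA _)).
  move=> s /AX /= [sT ->]; split => //.
  by rewrite normr0 exprn_ge0.
rewrite lee_fin; apply: (@le_trans _ _ ((`|T| + 1) * 2^-1 ^+ n)).
  apply: (@le_trans _ _ ((`|T| + 1) * 2^-1 ^+ (16 * (n1 + n)))).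
    rewrite ler_wpM2r ?exprn_ge0//; apply: (le_trans (ler_norm T)).
    by rewrite lerDl.
  rewrite ler_wpM2l ?addr_ge0// (_ : 16 * (n1 + n) = n + (15 * n + 16 * n1))%N; last by lia.
  by rewrite exprD ler_piMr ?exprn_ge0// exprn_ile1//; lra.
by rewrite mulrC -ler_pdivlMr ?ltW// ltr_wpDl.
Qed.

(** On the layer where [|w + y|] is between [2 ^ (- 30 (n + 1))] and
    [2 ^ (- 30 n)] the integrand is at most [2 ^ (15 (n + 1))], and this layer has
    measure at most [T * 2 ^ (- 16 n)]: the integral is dominated by a geometric
    series. *)
Lemma integrable_inv_sqrt {R : realType} (T K : R) (w y : R -> R) :
  0 < T -> sparse_near_zero T w -> {within `[0, T], continuous w} ->
  {within `[0, T], continuous y} ->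
  0 <= K -> lipschitz_on T K y ->
  lebesgue_measure.-integrable `[0, T]
    (EFin \o (fun s => (Num.sqrt `|w s + y s|)^-1)).
Proof.
move=> T0 sp cw cy K0 lip; have [n1 H] := sp K y K0 lip.
pose X s := w s + y s.
pose D := (`[0, T]%classic : set R).
have mD : measurable D by exact: measurable_itv.
have mX : measurable_fun D X.
  by apply: measurable_funD; apply: subspace_continuous_measurable_fun.
have mnX : measurable_fun D (fun s => `|X s|) by exact: measurableT_comp.
have mg : measurable_fun D (fun s => (Num.sqrt `|X s|)^-1).
  rewrite (_ : (fun s => _) = (@powR R ^~ (- 2^-1)) \o (fun s => `|X s|)).
    by apply: measurableT_comp => //; exact: measurable_powR.
  by apply/funext => s /=; rewrite powRN powR12_sqrt.
pose A n := D `&` [set s | `|X s| <= 2^-1 ^+ (30 * (n1 + n))].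
have mA n : measurable (A n).
  rewrite /A (_ : [set s | _] = (fun s => `|X s|) @^-1` `]-oo, 2^-1 ^+ (30 * (n1 + n))]).
    by apply: mnX => //; exact: measurable_itv.
  by apply/seteqP; split => s /=; rewrite in_itv.
apply/integrableP; split; first exact/measurable_EFinP.
pose u n s := (2 ^+ (15 * (n1 + n).+1) * \1_(A n) s : R).
have mu n : measurable_fun D (u n).
  by apply: measurable_funM => //; apply: measurable_funTS; exact: measurable_indic.
have u0 n s : 0 <= u n s by rewrite mulr_ge0 ?exprn_ge0.
have U0 s : (0 <= \sum_(n <oo) (u n s)%:E)%E.
  by apply: nneseries_ge0 => n _ _; rewrite lee_fin.
have mU : measurable_fun D (fun s => \sum_(n <oo) (u n s)%:E)%E.
  apply: ge0_emeasurable_sum => [n s _ _|n _]; first by rewrite lee_fin.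
  exact/measurable_EFinP.
have gU s : D s -> ((Num.sqrt `|X s|)^-1%:E <=
    (2 ^+ (15 * n1))%:E + \sum_(n <oo) (u n s)%:E)%E.
  move=> Ds.
  have sq n : 2^-1 ^+ (15 * n) = Num.sqrt (2^-1 ^+ (30 * n)) :> R.
    have -> : 2^-1 ^+ (30 * n) = (2^-1 ^+ (15 * n)) ^+ 2 :> R.
      by rewrite -exprM; congr (_ ^+ _); lia.
    by rewrite sqrtr_sqr ger0_norm// exprn_ge0.
  have small n : 2^-1 ^+ (30 * n) < `|X s| -> (Num.sqrt `|X s|)^-1 <= 2 ^+ (15 * n).
    move=> h; have h0 : 0 < `|X s| by apply: le_lt_trans h; rewrite exprn_ge0.
    rewrite -[leRHS]invrK -exprVn sq lef_pV2 ?posrE ?sqrtr_gt0 ?exprn_gt0//.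
    by rewrite ler_sqrt ?ltW.
  have [X0|X0] := eqVneq (X s) 0.
    by rewrite X0 normr0 sqrtr0 invr0 adde_ge0// lee_fin exprn_ge0.
  have nX0 : 0 < `|X s| by rewrite normr_gt0.
  have ex : exists n, 2^-1 ^+ (30 * n) < `|X s|.
    have [n hn] := exists_expr_lt nX0; exists n; apply: le_lt_trans hn.
    rewrite (_ : 30 * n = n + 29 * n)%N; last by lia.
    by rewrite exprD ler_piMr ?exprn_ge0// exprn_ile1//; lra.
  case: (ex_minnP ex) => m hm minm.
  have [mn1|n1m] := leqP m n1.
    apply: lee_paddr => //; rewrite lee_fin; apply: (le_trans (small m hm)).
    by rewrite ler_eXn2l ?ltr1n// leq_mul2l.
  apply: lee_paddl; first by rewrite lee_fin exprn_ge0.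
  apply: (@le_trans _ _ (u (m - n1.+1)%N s)%:E).
    rewrite lee_fin /u (_ : (n1 + (m - n1.+1)).+1 = m)%N; last by lia.
    apply: (le_trans (small m hm)); rewrite indicE mem_set ?mulr1//.
    split => //=; rewrite leNgt; apply/negP => h.
    by have := minm _ h; lia.
  apply: le_trans (nneseries_lim_ge (m - n1.+1).+1 _); last first.
    by move=> n _ _; rewrite lee_fin.
  rewrite big_nat_recr//=; apply: lee_paddl => //.
  by apply: sume_ge0 => n _; rewrite lee_fin.
apply: (@le_lt_trans _ _ (\int[lebesgue_measure]_(s in D)
   ((2 ^+ (15 * n1))%:E + \sum_(n <oo) (u n s)%:E))%E).
  apply: ge0_le_integral => //=.
  - by apply/measurable_EFinP; apply: measurableT_comp mg.
  - exact: emeasurable_funD.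
  - move=> s Ds; rewrite ger0_norm ?invr_ge0 ?sqrtr_ge0//; exact: gU.
rewrite ge0_integralD//=.
rewrite integral_nneseries//=; last 2 first.
- by move=> n; apply/measurable_EFinP; exact: mu.
- by move=> n s _; rewrite lee_fin.
rewrite integral_cst//.
have lD : (lebesgue_measure D < +oo)%E.
  by rewrite /D lebesgue_measure_itv /= lte_fin T0 oppr0 adde0 ltry.
apply: lte_add_pinfty.
  by apply: lte_mul_pinfty => //; rewrite lee_fin exprn_ge0.
apply: (@le_lt_trans _ _ (\sum_(0 <= n <oo) (2 * (2 ^+ 15 * T) / (2 ^ (n + 1))%:R)%:E)%E).
  apply: lee_nneseries => n _.
    by move=> _; apply: integral_ge0 => s _; rewrite lee_fin.
  have mi : measurable_fun D (fun s => (\1_(A n) s : R)%:E).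
    apply/measurable_EFinP; apply: measurable_funTS; exact: measurable_indic.
  rewrite [leLHS](_ : _ = ((2 ^+ (15 * (n1 + n).+1))%:E *
      \int[lebesgue_measure]_(s in D) (\1_(A n) s)%:E)%E); last first.
    by rewrite -ge0_integralZl// lee_fin exprn_ge0.
  rewrite integral_indic//; last exact: mA.
  apply: (le_trans (lee_wpmul2l _ (H (n1 + n)%N (A n `&` D) (leq_addr _ _) _ _))).
  - by rewrite lee_fin exprn_ge0.
  - exact: measurableI.
  - by move=> s [[Ds ?] _].
  rewrite -EFinM lee_fin.
  have -> : 2 * (2 ^+ 15 * T) / (2 ^ (n + 1))%:R = 2 ^+ 15 * T * 2^-1 ^+ n :> R.
    by rewrite addn1 natrX (exprS _ n) (exprVn _ n); field; rewrite expf_neq0.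
  have -> : (15 * (n1 + n).+1 = 15 + 15 * (n1 + n))%N by lia.
  have -> : (16 * (n1 + n) = (n1 + n) + 15 * (n1 + n))%N by lia.
  have E : 2 ^+ (15 * (n1 + n)) * 2^-1 ^+ (15 * (n1 + n)) = 1 :> R.
    by rewrite -exprMn divff// expr1n.
  set m := (15 * _)%N in E *.
  rewrite (exprD _ 15) (exprD _ (n1 + n)).
  rewrite [leLHS](_ : _ = 2 ^+ 15 * T * 2^-1 ^+ (n1 + n) *
      (2 ^+ m * 2^-1 ^+ m)); last by ring.
  rewrite E mulr1 ler_wpM2l ?mulr_ge0 ?exprn_ge0 ?(ltW T0)//.
  by rewrite addnC exprD ler_piMr ?exprn_ge0// exprn_ile1//; lra.
have /cvg_lim h := @cvg_geometric_eseries_half R (2 * (2 ^+ 15 * T)) 0.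
have {}h := h (@ereal_hausdorff R).
by rewrite h ltry.
Qed.

(** * Solutions along a fixed path *)

(** Growth shared by the drift and by all its regularizations, with the same
    constant.  That it is sublinear allows an a priori bound on solutions over
    [0, T] in one step, without iterating in time. *)
Definition sqrt_growth {R : realType} (f : R -> R) : Prop :=
  forall x, `|f x| <= 3 + Num.sqrt `|x|.

Lemma sqrt_growth_drift {R : realType} : sqrt_growth (@drift R).
Proof.
move=> x; rewrite /drift; case: ifPn => x0.
  by rewrite ger0_norm ?sqrtr_ge0// (ger0_norm x0) lerDr.
rewrite -ltNge in x0; rewrite (ltr0_norm x0) ger0_norm ?addr_ge0 ?sqrtr_ge0//.
by rewrite addrC lerD2r ler1n.
Qed.

Lemma measurable_sqrt {R : realType} : measurable_fun setT (@Num.sqrt R).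
Proof. by apply: continuous_measurable_fun; exact: sqrt_continuous. Qed.

Lemma measurable_drift {R : realType} : measurable_fun setT (@drift R).
Proof.
apply: measurable_fun_ifT => //.
- exact: measurable_fun_ler.
- exact: measurable_sqrt.
- apply: measurable_funD => //.
  by apply: measurableT_comp; [exact: measurable_sqrt|exact: oppr_measurable].
Qed.

Lemma within_continuousD {R : realType} (D : set R) (f g : R -> R) :
  {within D, continuous f} -> {within D, continuous g} ->
  {within D, continuous (fun s => f s + g s)}.
Proof. by move=> cf cg s; apply: continuousD; [exact: cf|exact: cg]. Qed.

Lemma within_continuousB {R : realType} (D : set R) (f g : R -> R) :
  {within D, continuous f} -> {within D, continuous g} ->
  {within D, continuous (fun s => f s - g s)}.
Proof. by move=> cf cg s; apply: continuousB; [exact: cf|exact: cg]. Qed.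

Lemma within_continuous_comp {R : realType} (D : set R) (f g : R -> R) :
  {within D, continuous f} -> continuous g ->
  {within D, continuous (g \o f)}.
Proof.
move=> cf cg s; apply: (@continuous_comp (subspace D) R R f g s (cf s)).
exact: cg.
 Qed.

Lemma within_continuous_bounded {R : realType} (T : R) (f : R -> R) :
  0 <= T -> {within `[0, T], continuous f} ->
  exists2 t, t \in `[0, T] & forall s, s \in `[0, T] -> `|f s| <= `|f t|.
Proof.
move=> T0 cf; apply: (@EVT_max _ (fun s => `|f s|)) => //.
by apply: (within_continuous_comp cf); exact: norm_continuous.
Qed.

Lemma integrable_along {R : realType} (f w y : R -> R) (T : R) :
  0 <= T -> measurable_fun setT f -> sqrt_growth f ->
  {within `[0, T], continuous w} -> {within `[0, T], continuous y} ->
  lebesgue_measure.-integrable `[0, T] (EFin \o (fun s => f (y s + w s))).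
Proof.
move=> T0 mf gf cw cy.
have cX := within_continuousD cy cw.
have [t tT tmax] := within_continuous_bounded T0 cX.
apply: measurable_bounded_integrable.
- exact: measurable_itv.
- rewrite /= lebesgue_measure_itv /=; case: ifP => _; by rewrite ?ltry// -EFinD ltry.
- apply: measurableT_comp => //; apply: subspace_continuous_measurable_fun => //.
- exists (3 + Num.sqrt `|y t + w t|); split; first exact: num_real.
  move=> M hM s /= sT; apply: (le_trans (gf _)); apply: le_trans (ltW hM).
  by rewrite lerD2l ler_sqrt// tmax.
Qed.

Lemma path_increment {R : realType} (f w y : R -> R) (T y0 a b : R) :
  lebesgue_measure.-integrable `[0, T] (EFin \o (fun s => f (y s + w s))) ->
  is_path_solution f T y0 w y -> 0 <= a -> a <= b -> b <= T ->
  y b - y a = \int[lebesgue_measure]_(s in `]a, b]) f (y s + w s).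
Proof.
move=> fi [_ ys] a0 ab bT.
rewrite !ys ?in_itv /= ?a0 ?bT ?(le_trans ab) ?(le_trans a0)//.
rewrite -(@Rintegral_itvB _ _ (BLeft 0) (BRight b) a).
- by ring.
- by apply: integrableS fi => //; apply: subset_itvl; rewrite bnd_simp.
- by rewrite bnd_simp.
- by rewrite bnd_simp.
Qed.

Lemma integrable_subitv {R : realType} (g : R -> R) (T a b : R) :
  lebesgue_measure.-integrable `[0, T] (EFin \o g) -> 0 <= a -> b <= T ->
  lebesgue_measure.-integrable `]a, b] (EFin \o g).
Proof.
move=> gi a0 bT; apply: integrableS gi => // s /=; rewrite !in_itv /= => /andP[h1 h2].
by rewrite (le_trans a0 (ltW h1)) (le_trans h2 bT).
Qed.

Lemma integrable_cst_itv {R : realType} (c a b : R) :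
  lebesgue_measure.-integrable `]a, b] (EFin \o (fun=> c)).
Proof.
apply: measurable_bounded_integrable => //=.
- by rewrite lebesgue_measure_itv /=; case: ifP => _; rewrite ?ltry// -EFinD ltry.
- by exists `|c|; split; rewrite ?num_real // => M /ltW hM s _.
Qed.

Lemma Rintegral_cst_itv {R : realType} (c a b : R) : a <= b ->
  \int[lebesgue_measure]_(s in `]a, b]) c = c * (b - a).
Proof.
move=> ab; rewrite Rintegral_cst//; congr (_ * _).
rewrite /= lebesgue_measure_itv /= lte_fin; case: (ltrP a b) => //= ba.
by rewrite (@le_anti _ _ a b) ?ab// subrr.
Qed.

Lemma path_start {R : realType} (f w y : R -> R) (T y0 : R) :
  0 <= T -> is_path_solution f T y0 w y -> y 0 = y0.
Proof.
move=> T0 [_ ys]; rewrite ys; last by rewrite in_itv /= lexx.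
by rewrite set_itv1 Rintegral_set1 addr0.
Qed.

Lemma path_increment_norm {R : realType} (f w y : R -> R) (T y0 a b C : R) :
  lebesgue_measure.-integrable `[0, T] (EFin \o (fun s => f (y s + w s))) ->
  is_path_solution f T y0 w y -> 0 <= a -> a <= b -> b <= T ->
  (forall s, s \in `[0, T] -> `|f (y s + w s)| <= C) ->
  `|y b - y a| <= C * (b - a).
Proof.
move=> fi ys a0 ab bT fC; rewrite (path_increment fi ys a0 ab bT).
have gi := integrable_subitv fi a0 bT.
apply: (le_trans (le_normr_Rintegral _ gi)) => //.
rewrite -Rintegral_cst_itv//; apply: le_Rintegral => //.
- exact: integrable_norm gi.
- exact: integrable_cst_itv.
- move=> s; rewrite /= in_itv /= => /andP[h1 h2]; apply: fC.
  by rewrite in_itv /= (le_trans a0 (ltW h1)) (le_trans h2 bT).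
Qed.

(** The value obtained by solving [A <= c0 + T (3 + sqrt (A + M))] for the
    maximum [A] of a solution, with [T sqrt (A + M) <= (T ^ 2 + A + M) / 2]. *)
Definition solution_bound {R : realType} (T c0 M : R) : R :=
  2 * c0 + 6 * T + T ^+ 2 + M.

Lemma path_solution_bounded {R : realType} (f w y : R -> R) (T y0 c0 M : R) :
  0 < T -> measurable_fun setT f -> sqrt_growth f ->
  {within `[0, T], continuous w} ->
  (forall s, s \in `[0, T] -> `|w s| <= M) -> `|y0| <= c0 ->
  is_path_solution f T y0 w y ->
  forall t, t \in `[0, T] -> `|y t| <= solution_bound T c0 M.
Proof.
move=> T0 mf gf cw wM y0c ys.
have cy := ys.1.
have fi := integrable_along (ltW T0) mf gf cw cy.
have [u uT umax] := within_continuous_bounded (ltW T0) cy.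
move=> t tT; apply: (le_trans (umax _ tT)).
have M0 : 0 <= M by exact: le_trans (wM _ tT).
set A := `|y u|; have A0 : 0 <= A by exact: normr_ge0.
pose C := 3 + Num.sqrt (A + M).
have fC s : s \in `[0, T] -> `|f (y s + w s)| <= C.
  move=> sT; apply: (le_trans (gf _)); rewrite lerD2l ler_sqrt ?addr_ge0//.
  by apply: (le_trans (ler_normD _ _)); apply: lerD; [exact: umax|exact: wM].
have C0 : 0 <= C by rewrite addr_ge0 ?sqrtr_ge0.
have [u0 uT'] : 0 <= u /\ u <= T by move: uT; rewrite in_itv /= => /andP[].
have h := path_increment_norm fi ys (lexx 0) u0 uT' fC.
rewrite (path_start (ltW T0) ys) subr0 in h.
have h1 : A <= `|y0| + C * T.
  rewrite /A -[y u](subrK y0) addrC; apply: (le_trans (ler_normD _ _)).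
  by rewrite lerD2l (le_trans h)// ler_wpM2l.
have := sqr_ge0 (Num.sqrt (A + M) - T).
have := sqr_sqrtr (addr_ge0 A0 M0).
move: h1; rewrite /C /solution_bound; set q := Num.sqrt _; move=> h1 h2 h3.
nra.
Qed.

Lemma path_solution_lipschitz {R : realType} (f w y : R -> R) (T y0 c0 M : R) :
  0 < T -> measurable_fun setT f -> sqrt_growth f ->
  {within `[0, T], continuous w} ->
  (forall s, s \in `[0, T] -> `|w s| <= M) -> `|y0| <= c0 ->
  is_path_solution f T y0 w y ->
  lipschitz_on T (3 + Num.sqrt (solution_bound T c0 M + M)) y.
Proof.
move=> T0 mf gf cw wM y0c ys.
have cy := ys.1.
have fi := integrable_along (ltW T0) mf gf cw cy.
have yb := path_solution_bounded T0 mf gf cw wM y0c ys.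
have fC s : s \in `[0, T] ->
    `|f (y s + w s)| <= 3 + Num.sqrt (solution_bound T c0 M + M).
  move=> sT; apply: (le_trans (gf _)); rewrite lerD2l ler_sqrt.
    by apply: (le_trans (ler_normD _ _)); apply: lerD; [exact: yb|exact: wM].
  by rewrite addr_ge0//; [exact: le_trans (yb _ sT)|exact: le_trans (wM _ sT)].
move=> a b /andP[a0 aT] /andP[b0 bT].
case: (leP a b) => [ab|/ltW ba].
  by rewrite [`|b - a|]ger0_norm ?subr_ge0//; exact: path_increment_norm fi ys a0 ab bT fC.
rewrite distrC [`|b - a|]distrC [`|a - b|]ger0_norm ?subr_ge0//.
exact: path_increment_norm fi ys b0 ba aT fC.
Qed.

(** The last zero before [t]: after it the two functions whose difference is
    [phi] are compared without any change of sign. *)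
Lemma last_nonpos {R : realType} (phi : R -> R) (T a t : R) :
  {within `[0, T], continuous phi} -> 0 <= a -> a <= t -> t <= T ->
  phi a <= 0 -> 0 < phi t ->
  exists t0, [/\ a <= t0, t0 < t, phi t0 = 0 &
    forall s, t0 < s -> s <= t -> 0 < phi s].
Proof.
move=> cphi a0 at_ tT pa pt.
pose S := [set s | a <= s <= t /\ phi s <= 0].
have Sa : S a by split; rewrite ?lexx ?at_.
have hS : has_sup S.
  by split; [exists a|exists t => s [/andP[]]].
pose t0 := sup S.
have at0 : a <= t0 by apply: ub_le_sup => //; case: hS.
have t0t : t0 <= t by apply: ge_sup; [exists a|move=> s [/andP[]]].
have t0T : t0 \in `[0, T] by rewrite in_itv /= (le_trans a0 at0) (le_trans t0t tT).
have pos s : t0 < s -> s <= t -> 0 < phi s.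
  move=> h1 h2; rewrite ltNge; apply/negP => h3.
  have : s <= t0.
    apply: ub_le_sup; first by case: hS.
    by split => //; rewrite h2 (le_trans at0 (ltW h1)).
  by rewrite leNgt h1.
have le0 : phi t0 <= 0.
  rewrite leNgt; apply/negP => p0.
  have [e e0 he] := within_continuous_eps cphi t0T p0.
  have [s Ss hs] := sup_adherent e0 hS.
  have sle : s <= t0 by apply: ub_le_sup => //; case: hS.
  case: Ss => /andP[as_ st] ps.
  have := he s; rewrite in_itv /= (le_trans a0 as_) (le_trans st tT) => /(_ isT).
  rewrite ger0_norm ?subr_ge0// => hh.
  have : `|phi t0 - phi s| < phi t0 by apply: hh; rewrite -/t0 in hs; lra.
  by rewrite ger0_norm ?subr_ge0; lra.
have t0lt : t0 < t.
  rewrite lt_neqAle t0t andbT; apply/eqP => E.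
  by move: le0; rewrite E leNgt pt.
exists t0; split => //.
apply/eqP; rewrite eq_le le0 leNgt; apply/negP => p0.
have np0 : 0 < - phi t0 by lra.
have [e e0 he] := within_continuous_eps cphi t0T np0.
pose s := Num.min t (t0 + e / 2).
have st : s <= t by rewrite ge_min lexx.
have t0s : t0 < s by rewrite lt_min t0lt; lra.
have se : s <= t0 + e / 2 by rewrite ge_min lexx orbT.
have := he s; rewrite in_itv /= (le_trans a0 (le_trans at0 (ltW t0s))) (le_trans st tT).
move=> /(_ isT); rewrite distrC gtr0_norm ?subr_gt0// => hh.
have h1 : `|phi t0 - phi s| < - phi t0 by apply: hh; lra.
have h2 := pos s t0s st.
by move: h1; rewrite ltr0_norm; lra.
Qed.

(** At the last time at which the solutions agree, the second one has the larger
    derivative and keeps it for a while, so the first one cannot overtake.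
    This needs the strict inequality between continuous drifts. *)
Lemma strict_comparison {R : realType} (f1 f2 w y1 y2 : R -> R) (T a1 a2 : R) :
  0 < T -> continuous f1 -> continuous f2 -> sqrt_growth f1 -> sqrt_growth f2 ->
  (forall x, f1 x < f2 x) -> {within `[0, T], continuous w} -> a1 <= a2 ->
  is_path_solution f1 T a1 w y1 -> is_path_solution f2 T a2 w y2 ->
  forall t, t \in `[0, T] -> y1 t <= y2 t.
Proof.
move=> T0 cf1 cf2 gf1 gf2 f12 cw a12 ys1 ys2 t.
rewrite in_itv /= => /andP[t0 tT].
rewrite leNgt; apply/negP => y21.
have cy1 := ys1.1; have cy2 := ys2.1.
have fi1 := integrable_along (ltW T0) (continuous_measurable_fun cf1) gf1 cw cy1.
have fi2 := integrable_along (ltW T0) (continuous_measurable_fun cf2) gf2 cw cy2.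
have cphi := within_continuousB cy1 cy2.
have [||u [u0 ut u1 upos]] := last_nonpos cphi (lexx 0) t0 tT.
- by rewrite (path_start (ltW T0) ys1) (path_start (ltW T0) ys2) subr_le0.
- by rewrite subr_gt0.
have uT : u \in `[0, T] by rewrite in_itv /= u0 (le_trans (ltW ut) tT).
pose g s := f2 (y2 s + w s) - f1 (y1 s + w s).
have cg : {within `[0, T], continuous g}.
  apply: within_continuousB.
  - exact: (within_continuous_comp (within_continuousD cy2 cw) cf2).
  - exact: (within_continuous_comp (within_continuousD cy1 cw) cf1).
have gu : 0 < g u.
  have E : y1 u = y2 u by apply/eqP; rewrite -subr_eq0 u1.
  by rewrite /g E subr_gt0.
have [e e0 he] := within_continuous_eps cg uT gu.
pose s := Num.min t (u + e / 2).
have st : s <= t by rewrite ge_min lexx.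
have us : u < s by rewrite lt_min ut; lra.
have se : s <= u + e / 2 by rewrite ge_min lexx orbT.
have sT := le_trans st tT.
have inc1 := path_increment fi1 ys1 u0 (ltW us) sT.
have inc2 := path_increment fi2 ys2 u0 (ltW us) sT.
have : y1 s - y1 u <= y2 s - y2 u.
  rewrite inc1 inc2; apply: le_Rintegral => //.
  - exact: integrable_subitv fi1 u0 sT.
  - exact: integrable_subitv fi2 u0 sT.
  move=> r; rewrite /= in_itv /= => /andP[ur rs].
  have := he r; rewrite in_itv /= (le_trans u0 (ltW ur)) (le_trans rs sT) => /(_ isT).
  rewrite distrC gtr0_norm ?subr_gt0// => hh.
  have : `|g u - g r| < g u by apply: hh; lra.
  by rewrite ltr_norml /g; lra.
by have := upos s us st; lra.
Qed.

(** * Uniqueness *)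

(** Right after the last zero [u] the integral of [g] is at most 1/2 and [phi]
    stays below 1; the maximum of [phi] there would be at most half of
    itself. *)
Lemma gronwall_nonpos {R : realType} (phi g : R -> R) (T : R) :
  0 < T -> {within `[0, T], continuous phi} -> phi 0 <= 0 ->
  lebesgue_measure.-integrable `[0, T] (EFin \o g) ->
  (forall a b c, 0 <= a -> a < b -> b <= T -> c < 1 ->
     (forall s, s \in `]a, b] -> 0 < phi s <= c) ->
     phi b - phi a <= c * \int[lebesgue_measure]_(s in `]a, b]) g s) ->
  forall t, t \in `[0, T] -> phi t <= 0.
Proof.
move=> T0 cphi phi0 gi H t; rewrite in_itv /= => /andP[t0 tT].
rewrite leNgt; apply/negP => pt.
have [u [u0 ut pu upos]] := last_nonpos cphi (lexx 0) t0 tT phi0 pt.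
have uT : u \in `[0, T] by rewrite in_itv /= u0 (le_trans (ltW ut) tT).
have cG : {within `[0, T], continuous (fun x => \int[lebesgue_measure]_(s in `[0, x]) g s)}.
  exact: parameterized_integral_continuous (ltW T0) gi.
have half0 : 0 < 2^-1 :> R by rewrite invr_gt0.
have [e1 e10 h1] := within_continuous_eps cphi uT ltr01.
have [e2 e20 h2] := within_continuous_eps cG uT half0.
pose e := Num.min e1 e2.
have e0 : 0 < e by rewrite lt_min e10.
pose v := Num.min t (u + e / 2).
have vt : v <= t by rewrite ge_min lexx.
have uv : u < v by rewrite lt_min ut; lra.
have ve : v <= u + e / 2 by rewrite ge_min lexx orbT.
have vT := le_trans vt tT.
have near s : u < s -> s <= v -> `|u - s| < e1 /\ `|u - s| < e2 /\ s \in `[0, T].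
  move=> us sv; have : `|u - s| < e by rewrite distrC gtr0_norm ?subr_gt0; lra.
  rewrite lt_min => /andP[-> ->]; rewrite in_itv /= (le_trans u0 (ltW us)).
  by rewrite (le_trans sv vT).
have cuv : {within `[u, v], continuous phi}.
  apply: continuous_subspaceW cphi => s /=; rewrite !in_itv /= => /andP[a b].
  by rewrite (le_trans u0 a) (le_trans b vT).
have [c cI cmax] := EVT_max (ltW uv) cuv.
have vmem : v \in `[u, v] by rewrite in_itv /= lexx ltW.
have pc : 0 < phi c by apply: lt_le_trans (upos v uv vt) (cmax v vmem).
have [uc cv] : u < c /\ c <= v.
  move: cI; rewrite in_itv /= => /andP[uc cv]; split => //.
  rewrite lt_neqAle uc andbT; apply/eqP => E; by move: pc; rewrite -E pu ltxx.
have [n1 [n2 cT]] := near c uc cv.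
have c1 : phi c < 1.
  by have := h1 c cT n1; rewrite pu sub0r normrN gtr0_norm.
have cT' : c <= T by exact: le_trans cv vT.
have := H u c (phi c) u0 uc cT' c1.
rewrite pu subr0 => Hc.
have {}Hc : phi c <= phi c * \int[lebesgue_measure]_(s in `]u, c]) g s.
  apply: Hc => s; rewrite in_itv /= => /andP[us sc].
  rewrite upos//=; last by rewrite (le_trans sc) ?(le_trans cv).
  by apply: cmax; rewrite in_itv /= (ltW us) (le_trans sc cv).
have := h2 c cT n2.
have := @Rintegral_itvB _ g (BLeft 0) (BRight c) u.
rewrite !bnd_simp => /(_ _ u0 (ltW uc)) E.
rewrite distrC E; last first.
  apply: integrableS gi => // s /=; rewrite !in_itv /= => /andP[-> h].
  exact: le_trans h cT'.
move=> /ltr_normlW h.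
have : phi c * \int[lebesgue_measure]_(s in `]u, c]) g s <= phi c * 2^-1.
  by rewrite ler_pM2l// ltW.
lra.
Qed.

Lemma sqrt_increment {R : realType} (x y : R) : 0 < y -> 0 <= x ->
  `|Num.sqrt x - Num.sqrt y| <= `|x - y| / Num.sqrt y.
Proof.
move=> y0 x0; have sy0 : 0 < Num.sqrt y by rewrite sqrtr_gt0.
rewrite ler_pdivlMr//.
have -> : x - y = (Num.sqrt x - Num.sqrt y) * (Num.sqrt x + Num.sqrt y).
  by rewrite -[in LHS](sqr_sqrtr x0) -[in LHS](sqr_sqrtr (ltW y0)); ring.
rewrite normrM ler_wpM2l// ger0_norm ?addr_ge0 ?sqrtr_ge0//.
by rewrite lerDr sqrtr_ge0.
Qed.

(** For [X < 0 <= x] the downward jump of size 1 outweighs [sqrt x], as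
    [x < 1]. *)
Lemma drift_increment_right {R : realType} (x X : R) : X != 0 -> X < x -> x - X < 1 ->
  drift x - drift X <= (x - X) / Num.sqrt `|X|.
Proof.
move=> X0 Xx xX1.
have rhs0 : 0 <= (x - X) / Num.sqrt `|X|.
  by rewrite divr_ge0 ?sqrtr_ge0// subr_ge0 ltW.
rewrite /drift; case: (ltrgtP 0 X) X0 => // hX _.
  have x0 : 0 <= x by rewrite ltW// (lt_trans hX).
  rewrite x0 (gtr0_norm hX); apply: le_trans (ler_norm _) _.
  by apply: (le_trans (sqrt_increment hX x0)); rewrite gtr0_norm ?subr_gt0.
apply: le_trans rhs0; case: (leP 0 x) => hx.
  have : Num.sqrt x <= 1 by rewrite -sqrtr1 ler_sqrt//; lra.
  have := sqrtr_ge0 (- X); lra.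
rewrite opprD addrACA subrr addr0 subr_le0 ler_sqrt; lra.
Qed.

Lemma drift_increment_left {R : realType} (x X : R) : X != 0 -> x < X -> X - x < 1 ->
  drift X - drift x <= (X - x) / Num.sqrt `|X|.
Proof.
move=> X0 Xx xX1.
have rhs0 : 0 <= (X - x) / Num.sqrt `|X|.
  by rewrite divr_ge0 ?sqrtr_ge0// subr_ge0 ltW.
rewrite /drift; case: (ltrgtP 0 X) X0 => // hX _.
  case: (leP 0 x) => hx.
    rewrite (gtr0_norm hX); apply: le_trans (ler_norm _) _; rewrite distrC.
    by apply: (le_trans (sqrt_increment hX hx)); rewrite distrC gtr0_norm ?subr_gt0.
  apply: le_trans rhs0.
  have : Num.sqrt X <= 1 by rewrite -sqrtr1 ler_sqrt//; lra.
  have := sqrtr_ge0 (- x); lra.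
apply: le_trans rhs0; rewrite [0 <= x]leNgt (lt_trans Xx hX) /=.
rewrite opprD addrACA subrr addr0 subr_le0 ler_sqrt; lra.
Qed.

(** The Gronwall argument is applied to [y - z] and to [z - y].  The null set on
    which [w + z] vanishes, where [1 / sqrt |w + z|] is no bound, is handled by
    adding the indicator of this set. *)
Lemma drift_path_unique {R : realType} (T K : R) (w y z : R -> R) :
  0 < T -> {within `[0, T], continuous w} -> sparse_near_zero T w ->
  0 <= K -> lipschitz_on T K z ->
  is_path_solution drift T 0 w z -> is_path_solution drift T 0 w y ->
  forall t, t \in `[0, T] -> y t = z t.
Proof.
move=> T0 cw sp K0 lip zs ys.
have cy := ys.1; have cz := zs.1.
have mdrift := @measurable_drift R; have gdrift := @sqrt_growth_drift R.
have fz := integrable_along (ltW T0) mdrift gdrift cw cz.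
have fy := integrable_along (ltW T0) mdrift gdrift cw cy.
pose X s := w s + z s.
pose g s := (Num.sqrt `|X s|)^-1.
have gi : lebesgue_measure.-integrable `[0, T] (EFin \o g).
  exact: integrable_inv_sqrt T0 sp cw cz K0 lip.
pose N := `[0, T]%classic `&` X @^-1` [set 0].
have mN : measurable N.
  have mX : measurable_fun `[0, T]%classic X.
    by apply: subspace_continuous_measurable_fun => //; exact: within_continuousD.
  by apply: mX => //; exact: measurable_set1.
have N0 : lebesgue_measure N = 0%E.
  by apply: (sparse_null sp K0 lip mN) => s [sT /= Xs]; split.
have NI a b : lebesgue_measure (N `&` `]a, b]%classic) = 0%E.
  apply: (sparse_null sp K0 lip); first by apply: measurableI => //.
  by move=> s [[sT /= Xs] _]; split.
(* At a zero of [X] the bound on [h] has an extra 1, integrated over a null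
   set. *)
have int_le (a b c : R) (h : R -> R) : 0 <= a -> a < b -> b <= T ->
    lebesgue_measure.-integrable `]a, b] (EFin \o h) ->
    (forall s, s \in `]a, b] -> X s != 0 -> h s <= c * g s) ->
    (forall s, s \in `]a, b] -> h s <= 1 + c * g s) ->
    \int[lebesgue_measure]_(s in `]a, b]) h s <=
    c * \int[lebesgue_measure]_(s in `]a, b]) g s.
  move=> a0 ab bT hi hX h1.
  have gab := integrable_subitv gi a0 bT.
  have cgab : lebesgue_measure.-integrable `]a, b] (EFin \o (fun s => c * g s)).
    exact: (integrableZl _ c gab).
  have Ni : lebesgue_measure.-integrable `]a, b] (EFin \o \1_N).
    apply: measurable_bounded_integrable => //=.
    - by rewrite lebesgue_measure_itv /=; case: ifP => _; rewrite ?ltry// -EFinD ltry.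
    - exists 1; split; rewrite ?num_real// => M /ltW hM s _.
      by rewrite /= indicE; case: (_ \in _); rewrite ?normr1 ?normr0 ?(le_trans _ hM).
  apply: (@le_trans _ _ (\int[lebesgue_measure]_(s in `]a, b]) (\1_N s + c * g s))).
    apply: le_Rintegral => //.
      exact: (integrableD _ Ni cgab).
    move=> s sab; have [X0|X0] := eqVneq (X s) 0.
      rewrite indicE mem_set; first exact: h1.
      split => //=; move: sab; rewrite /= !in_itv /= => /andP[h2 h3].
      by rewrite (le_trans a0 (ltW h2)) (le_trans h3 bT).
    rewrite indicE memNset ?add0r; first exact: hX.
    by move=> [_ /= X00]; rewrite X00 eqxx in X0.
  rewrite RintegralD// RintegralZl//.
  rewrite [X in X + _](_ : _ = 0) ?add0r//.
  rewrite /Rintegral integral_indic// [X in fine X](_ : _ = 0%E)//.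
  exact: NI.
have le1 : forall t, t \in `[0, T] -> y t - z t <= 0.
  apply: (gronwall_nonpos T0 (within_continuousB cy cz) _ gi).
    by rewrite (path_start (ltW T0) ys) (path_start (ltW T0) zs) subrr.
  move=> a b c a0 ab bT c1 hc.
  have -> : y b - z b - (y a - z a) = (y b - y a) - (z b - z a) by ring.
  rewrite (path_increment fy ys a0 (ltW ab) bT) (path_increment fz zs a0 (ltW ab) bT).
  have fyab := integrable_subitv fy a0 bT.
  have fzab := integrable_subitv fz a0 bT.
  rewrite -RintegralB//; apply: int_le => //.
  - exact: (integrableB _ fyab fzab).
  - move=> s sab X0; have /andP[h1 h2] := hc s sab.
    rewrite [z s + w s]addrC -/(X s).
    apply: (le_trans (drift_increment_right X0 _ _)); rewrite /X; try lra.
    by rewrite ler_wpM2r ?invr_ge0 ?sqrtr_ge0//; lra.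
  - move=> s sab; have /andP[h1 h2] := hc s sab.
    have cg0 : 0 <= c * g s by rewrite mulr_ge0 ?invr_ge0 ?sqrtr_ge0//; lra.
    have [X0|X0] := eqVneq (X s) 0; last first.
      rewrite [z s + w s]addrC -/(X s).
      apply: (le_trans (drift_increment_right X0 _ _)); rewrite /X; try lra.
      apply: (@le_trans _ _ (c * g s)); last lra.
      by rewrite ler_wpM2r ?invr_ge0 ?sqrtr_ge0//; lra.
    rewrite [z s + w s]addrC -/(X s) X0 /drift lexx sqrtr0 subr0.
    have E : y s + w s = y s - z s by move: X0; rewrite /X; lra.
    rewrite E (ltW h1) (@le_trans _ _ 1)//; last by lra.
    by rewrite -sqrtr1 ler_sqrt//; lra.
have le2 : forall t, t \in `[0, T] -> z t - y t <= 0.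
  apply: (gronwall_nonpos T0 (within_continuousB cz cy) _ gi).
    by rewrite (path_start (ltW T0) ys) (path_start (ltW T0) zs) subrr.
  move=> a b c a0 ab bT c1 hc.
  have -> : z b - y b - (z a - y a) = (z b - z a) - (y b - y a) by ring.
  rewrite (path_increment fy ys a0 (ltW ab) bT) (path_increment fz zs a0 (ltW ab) bT).
  have fyab := integrable_subitv fy a0 bT.
  have fzab := integrable_subitv fz a0 bT.
  rewrite -RintegralB//; apply: int_le => //.
  - exact: (integrableB _ fzab fyab).
  - move=> s sab X0; have /andP[h1 h2] := hc s sab.
    rewrite [z s + w s]addrC -/(X s).
    apply: (le_trans (drift_increment_left X0 _ _)); rewrite /X; try lra.
    by rewrite ler_wpM2r ?invr_ge0 ?sqrtr_ge0//; lra.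
  - move=> s sab; have /andP[h1 h2] := hc s sab.
    have cg0 : 0 <= c * g s by rewrite mulr_ge0 ?invr_ge0 ?sqrtr_ge0//; lra.
    have [X0|X0] := eqVneq (X s) 0; last first.
      rewrite [z s + w s]addrC -/(X s).
      apply: (le_trans (drift_increment_left X0 _ _)); rewrite /X; try lra.
      apply: (@le_trans _ _ (c * g s)); last lra.
      by rewrite ler_wpM2r ?invr_ge0 ?sqrtr_ge0//; lra.
    rewrite [z s + w s]addrC -/(X s) X0 /drift lexx sqrtr0 sub0r.
    have hy : y s + w s < 0 by move: X0; rewrite /X; lra.
    by rewrite [0 <= _]leNgt hy /=; have := sqrtr_ge0 (- (y s + w s)); lra.
by move=> t tT; have := le1 t tT; have := le2 t tT; lra.
Qed.

(** * The regularized drifts *)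

Definition clamp {R : realType} (n : nat) (x : R) : R :=
  Num.max (- n%:R) (Num.min x n%:R).

Lemma continuous_clamp {R : realType} (n : nat) : continuous (@clamp R n).
Proof.
rewrite (_ : @clamp R n = (fun=> - n%:R) \max (id \min (fun=> n%:R)))// => x.
apply: continuous_max; first exact: cst_continuous.
by apply: continuous_min; [exact: cvg_id|exact: cst_continuous].
Qed.

Lemma frozen_polyE {R : realType} (n : nat) (q : {poly R}) (x : R) :
  frozen_poly n q x = q.[clamp n x].
Proof.
have nn : - n%:R <= n%:R :> R by rewrite ge0_cp// ler0n.
rewrite /frozen_poly /clamp; case: (leP n%:R x) => nx.
  by rewrite max_r.
by case: (leP x (- n%:R)).
Qed.

Lemma continuous_frozen_poly {R : realType} (n : nat) (q : {poly R}) :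
  continuous (frozen_poly n q).
Proof.
rewrite (_ : frozen_poly n q = horner q \o clamp n); last first.
  by apply/funext => x; rewrite frozen_polyE.
move=> x; apply: continuous_comp; first exact: continuous_clamp.
exact: continuous_horner.
Qed.

Lemma clamp_itv {R : realType} (n : nat) (x : R) : clamp n x \in `[- n%:R, n%:R].
Proof.
have nn : - n%:R <= n%:R :> R by rewrite ge0_cp// ler0n.
by rewrite in_itv /= /clamp le_max lexx /= ge_max nn ge_min lexx orbT.
Qed.

Lemma clamp_id {R : realType} (n : nat) (x : R) : `|x| <= n%:R -> clamp n x = x.
Proof.
by rewrite ler_norml => /andP[h1 h2]; rewrite /clamp (min_l h2) max_r.
Qed.

Lemma norm_clamp_le {R : realType} (n : nat) (x : R) : `|clamp n x| <= `|x|.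
Proof.
rewrite /clamp; case: (leP x n%:R) => h.
  case: (leP (- n%:R) x) => h' //.
  rewrite normrN (ger0_norm (ler0n _ _)) ltr0_norm; have := ler0n R n; lra.
have nn : - n%:R <= n%:R :> R by rewrite ge0_cp// ler0n.
rewrite max_r// (ger0_norm (ler0n _ _)); apply: le_trans (ler_norm x); exact: ltW.
Qed.

Lemma drift_n_mid {R : realType} (n : nat) (u : R) : (0 < n)%N ->
  0 <= u -> u <= n%:R^-1 ->
  0 <= (n%:R + Num.sqrt n%:R) * u <= 1 + Num.sqrt u.
Proof.
move=> n0 u0 un; have nR0 : 0 < n%:R :> R by rewrite ltr0n.
rewrite mulr_ge0 ?addr_ge0 ?sqrtr_ge0 ?ler0n//=.
have nu : n%:R * u <= 1 by rewrite mulrC -ler_pdivlMr// mul1r.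
rewrite mulrDl lerD//.
have -> : Num.sqrt n%:R * u = Num.sqrt u * Num.sqrt (n%:R * u).
  rewrite sqrtrM ?ler0n// mulrCA mulrA -mulrA -expr2 sqr_sqrtr//.
by rewrite ler_piMr ?sqrtr_ge0// -[leRHS]sqrtr1 ler_sqrt.
Qed.

Lemma drift_n_growth {R : realType} (n : nat) (x : R) : (0 < n)%N ->
  `|drift_n n x| <= 2 + Num.sqrt `|x|.
Proof.
move=> n0; have nR1 : 1 <= n%:R :> R by rewrite ler1n.
have ni0 : 0 < n%:R^-1 :> R by rewrite invr_gt0; lra.
have ni1 : n%:R^-1 <= 1 :> R by rewrite invf_le1//; lra.
rewrite /drift_n; case: (ltP 0 x) => x0.
  rewrite (gtr0_norm x0); have := sqrtr_ge0 x; rewrite ler_norml; lra.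
case: (ltP x (- n%:R^-1)) => xn.
  rewrite (ler0_norm x0); have := sqrtr_ge0 (- x); rewrite ler_norml; lra.
have un : - x <= n%:R^-1 by lra.
have u0 : 0 <= - x by lra.
have /andP[h1 h2] := drift_n_mid n0 u0 un.
rewrite (ler0_norm x0); have := sqrtr_ge0 (- x); rewrite ler_norml.
by rewrite mulNr -mulrN; lra.
Qed.

Lemma eps_nE {R : realType} (n : nat) : (0 < n)%N ->
  2 * @eps_n R n = n%:R^-1 - n.+1%:R^-1.
Proof.
move=> n0; rewrite /eps_n -natr1; field.
by rewrite pnatr_eq0 -lt0n n0 /= gt_eqF// ltr_wpDl.
Qed.

Lemma eps_n_gt0 {R : realType} (n : nat) : (0 < n)%N -> 0 < @eps_n R n.
Proof.
by move=> n0; rewrite /eps_n invr_gt0 !mulr_gt0 ?ltr0n// ltr_wpDl.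
Qed.

Lemma eps_n_le {R : realType} (n : nat) : (0 < n)%N -> @eps_n R n <= n%:R^-1.
Proof.
move=> n0; have := @eps_nE R n n0; have : 0 <= n.+1%:R^-1 :> R by rewrite invr_ge0.
move: (@eps_n_gt0 R n n0); set a := n%:R^-1; set b := n.+1%:R^-1.
by set e := eps_n n => e0 b0 ab; lra.
Qed.

Lemma eps_nS {R : realType} (n : nat) : (0 < n)%N -> @eps_n R n.+1 <= eps_n n.
Proof.
move=> n0; rewrite /eps_n lef_pV2 ?posrE ?mulr_gt0 ?ltr0n// ?ltr_wpDl//.
have := ler0n R n; rewrite -natr1; nra.
Qed.

(** The shifts by [1 / n] leave between consecutive regularizations a gap of
    [2 eps_n n], which exceeds the sum of the two polynomial errors. *)
Lemma drift_nS {R : realType} (n : nat) (x : R) : (0 < n)%N ->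
  drift_n n x + 2 * eps_n n <= drift_n n.+1 x.
Proof.
move=> n0; rewrite eps_nE//.
have nR1 : 1 <= n%:R :> R by rewrite ler1n.
have ni : n.+1%:R^-1 < n%:R^-1 :> R.
  by rewrite ltf_pV2 ?posrE ?ltr0n// ltr_nat.
have mid := @drift_n_mid R n (- x) n0.
have sq : Num.sqrt n%:R <= Num.sqrt n.+1%:R :> R by rewrite ler_sqrt ?ler0n// ler_nat.
have nS : n%:R <= n.+1%:R :> R by rewrite ler_nat.
rewrite /drift_n; move: ni mid sq nS.
set a := n%:R^-1; set b := n.+1%:R^-1; set sn := Num.sqrt n%:R.
set sm := Num.sqrt n.+1%:R; set m := n.+1%:R => ni mid sq nS.
case: (ltP 0 x) => x0; first lra.
have u0 : 0 <= - x by lra.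
case: (ltP x (- a)) => xn; first by rewrite ifT; lra.
case: (ltP x (- b)) => xn'.
  have un : - x <= a by lra.
  by have /andP[_ h2] := mid u0 un; lra.
have : (n%:R + sn) * - x <= (m + sm) * - x by rewrite ler_wpM2r//; lra.
lra.
Qed.

(** Both branches of the drift grow away from 0, so freezing it further out
    increases it. *)
Lemma drift_n_clampS {R : realType} (n : nat) (x : R) : (0 < n)%N ->
  drift_n n.+1 (clamp n x) <= drift_n n.+1 (clamp n.+1 x).
Proof.
move=> n0; have nR1 : 1 <= n%:R :> R by rewrite ler1n.
have nS : n.+1%:R = n%:R + 1 :> R by rewrite natr1.
have nSi : n.+1%:R^-1 < 1 :> R by rewrite invf_lt1 ?ltr0n// nS; lra.
have [h|h] := leP `|x| n%:R.
  by rewrite !clamp_id// nS; lra.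
move: h; rewrite ltr_normr => /orP[h|h].
  have -> : clamp n x = n%:R by rewrite /clamp min_r ?ltW// max_r; lra.
  set c := clamp _ _; have hc : n%:R <= c.
    by rewrite /c /clamp le_max le_min (ltW h) nS; apply/orP; right; lra.
  by rewrite /drift_n !ifT ?lerD2r ?ler_sqrt//; lra.
have -> : clamp n x = - n%:R by rewrite /clamp min_l ?max_l; lra.
set c := clamp _ _; have hc : c <= - n%:R.
  by rewrite /c /clamp ge_max ge_min nS; apply/andP; split; [lra|apply/orP; left; lra].
rewrite /drift_n; move: nSi; set b := n.+1%:R^-1 => nSi.
case: (ltP 0 (- n%:R)) => ?; first lra.
case: (ltP 0 c) => ?; first lra.
rewrite !ifT; [|lra|lra].
by rewrite !lerD2r opprK ler_sqrt; lra.
Qed.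

Lemma frozen_poly_lt {R : realType} (n : nat) (p : nat -> {poly R}) (x : R) :
  (forall n : nat, (0 < n)%N -> forall x : R, x \in `[- n%:R, n%:R] ->
     `|drift_n n x - (p n).[x]| < eps_n n) -> (0 < n)%N ->
  frozen_poly n (p n) x < frozen_poly n.+1 (p n.+1) x.
Proof.
move=> happ n0; rewrite !frozen_polyE.
have := happ n n0 _ (clamp_itv n x); rewrite ltr_norml => /andP[h1 _].
have := happ n.+1 (ltn0Sn n) _ (clamp_itv n.+1 x); rewrite ltr_norml => /andP[_ h2].
have := drift_nS (clamp n x) n0; have := drift_n_clampS x n0.
by have := @eps_nS R n n0; lra.
Qed.

Lemma sqrt_growth_frozen {R : realType} (n : nat) (p : nat -> {poly R}) :
  (forall n : nat, (0 < n)%N -> forall x : R, x \in `[- n%:R, n%:R] ->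
     `|drift_n n x - (p n).[x]| < eps_n n) -> (0 < n)%N ->
  sqrt_growth (frozen_poly n (p n)).
Proof.
move=> happ n0 x; rewrite frozen_polyE.
have h1 := happ n n0 _ (clamp_itv n x).
have h2 := drift_n_growth (clamp n x) n0.
have h3 : Num.sqrt `|clamp n x| <= Num.sqrt `|x| by rewrite ler_sqrt// norm_clamp_le.
have h4 := @eps_n_le R n n0.
have h5 : n%:R^-1 <= 1 :> R by rewrite invf_le1 ?ltr0n// ler1n.
set q := _.[_] in h1 *; set b := drift_n _ _ in h1 h2.
have -> : q = b - (b - q) by ring.
by apply: (le_trans (ler_normB _ _)); lra.
Qed.

(** The limit [l] is nonzero, so from some index on [x n] is outside the interval
    on which the jump is interpolated. *)
Lemma frozen_poly_cvg {R : realType} (p : nat -> {poly R}) (x : nat -> R) (l : R) :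
  (forall n : nat, (0 < n)%N -> forall x : R, x \in `[- n%:R, n%:R] ->
     `|drift_n n x - (p n).[x]| < eps_n n) -> l != 0 ->
  x @ \oo --> l ->
  frozen_poly n (p n) (x n) @[n --> \oo] --> drift l.
Proof.
move=> happ l0 xl.
have ninv : n%:R^-1 @[n --> \oo] --> (0 : R).
  by rewrite -cvg_shiftS; exact: cvg_harmonic.
pose B n := if 0 <= l then Num.sqrt (x n) - n%:R^-1
  else Num.sqrt (- x n) + 1 - n%:R^-1.
have cB : B @ \oo --> drift l.
  rewrite /B /drift; case: ifP => _.
    rewrite -[Num.sqrt l]subr0; apply: cvgB => //.
    by apply: continuous_cvg => //; exact: sqrt_continuous.
  rewrite -[_ + 1]subr0; apply: cvgB => //; apply: cvgD; last exact: cvg_cst.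
  apply: continuous_cvg; first exact: sqrt_continuous.
  exact: cvgN.
have xbd : \forall n \near \oo, `|x n| <= n%:R.
  have h : \forall n \near \oo, `|x n| < `|l| + 1.
    by apply: (cvgr_lt `|l|); [exact: cvg_norm|lra].
  have h' : \forall n \near \oo, `|l| + 1 <= n%:R by exact: nbhs_infty_ger.
  by near=> n; apply: ltW; apply: (@lt_le_trans _ _ (`|l| + 1)); near: n.
have close : \forall n \near \oo, `|B n - frozen_poly n (p n) (x n)| <= n%:R^-1.
  have eqB : \forall n \near \oo, B n = drift_n n (x n).
    rewrite /B; case: (ltrgtP 0 l) l0 => // hl _.
      have xpos : \forall n \near \oo, 0 < x n by exact: (cvgr_gt l).
      by near=> n; rewrite /drift_n ifT//; near: n.
    have xneg : \forall n \near \oo, x n + n%:R^-1 < 0.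
      by apply: (cvgr_lt l) => //; rewrite -[l]addr0; exact: cvgD.
    near=> n.
    have hn : x n + n%:R^-1 < 0 by near: n.
    have ni : 0 <= n%:R^-1 :> R by rewrite invr_ge0.
    rewrite /drift_n ifF; last by apply/negP => ?; lra.
    by rewrite ifT//; lra.
  near=> n.
  have n0 : (0 < n)%N by near: n; exact: nbhs_infty_gt.
  have -> : B n = drift_n n (x n) by near: n.
  have xn : `|x n| <= n%:R by near: n.
  rewrite frozen_polyE clamp_id//; apply: (le_trans (ltW _) (eps_n_le n0)).
  by apply: happ => //; rewrite in_itv /= -ler_norml.
have diff0 : B n - frozen_poly n (p n) (x n) @[n --> \oo] --> (0 : R).
  apply/cvgr0Pnorm_le => e e0.
  have h : \forall n \near \oo, n%:R^-1 < e by exact: (cvgr_lt (0 : R)).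
  near=> n; apply: (@le_trans _ _ n%:R^-1); first by near: n.
  by apply: ltW; near: n.
rewrite (_ : (fun n => _) = (fun n => B n - (B n - frozen_poly n (p n) (x n)))).
  by rewrite -[drift l]subr0; exact: cvgB.
by apply/funext => n; ring.
Unshelve. all: by end_near. Qed.

(** * The limit of the approximating solutions *)

Lemma lipschitz_within_continuous {R : realType} (T K : R) (y : R -> R) :
  0 <= K -> lipschitz_on T K y -> {within `[0, T], continuous y}.
Proof.
move=> K0 lip; apply/subspace_continuousP => s sT.
apply/cvgrPdist_lt => e e0.
have K1 : 0 < K + 1 by rewrite ltr_wpDl.
rewrite near_withinE; apply/nbhs_ballP; exists (e / (K + 1)); first exact: divr_gt0.
move=> t; rewrite /ball /= => st tT.
move: tT sT; rewrite /= !in_itv /= => tT sT.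
have h := lip t s tT sT.
apply: (le_lt_trans h); move: st; rewrite ltr_pdivlMr// => st.
have := normr_ge0 (s - t); nra.
Qed.

Lemma limit_path_solution {R : realType} (T : R) (w : R -> R)
    (p : nat -> {poly R}) (teps : nat -> R) (y : nat -> R -> R) :
  0 < T -> {within `[0, T], continuous w} -> sparse_near_zero T w ->
  (forall n : nat, (0 < n)%N -> forall x : R, x \in `[- n%:R, n%:R] ->
     `|drift_n n x - (p n).[x]| < eps_n n) ->
  (forall m : nat, (0 < m)%N -> 0 < teps m) ->
  (forall m : nat, (0 < m)%N -> teps m.+1 <= teps m) ->
  teps m @[m --> \oo] --> 0 ->
  (forall m : nat, (0 < m)%N ->
     is_path_solution (frozen_poly m (p m)) T (- teps m) w (y m)) ->
  let z t := lim (y m t @[m --> \oo]) in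
  exists K, [/\ 0 <= K, lipschitz_on T K z & is_path_solution drift T 0 w z].
Proof.
move=> T0 cw sp happ teps0 tepsn teps_cvg ysol z.
have [tw twT wM] := within_continuous_bounded (ltW T0) cw.
set M := `|w tw| in wM.
have teps1 m : `|- teps m.+1| <= teps 1%N.
  rewrite normrN gtr0_norm ?teps0//.
  by elim: m => // m; apply: le_trans; exact: tepsn.
have cF n := @continuous_frozen_poly R n.+1 (p n.+1).
have mF n := continuous_measurable_fun (cF n).
have gF n := sqrt_growth_frozen happ (ltn0Sn n).
have ys n := ysol n.+1 (ltn0Sn n).
set B := solution_bound T (teps 1%N) M.
pose C := 3 + Num.sqrt (B + M).
have yb n t : t \in `[0, T] -> `|y n.+1 t| <= B.
  exact: path_solution_bounded T0 (mF n) (gF n) cw wM (teps1 n) (ys n) t.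
have ylip n : lipschitz_on T C (y n.+1).
  exact: path_solution_lipschitz T0 (mF n) (gF n) cw wM (teps1 n) (ys n).
have C0 : 0 <= C by rewrite addr_ge0 ?sqrtr_ge0.
have fC n s : s \in `[0, T] -> `|frozen_poly n.+1 (p n.+1) (y n.+1 s + w s)| <= C.
  move=> sT; apply: (le_trans (gF n _)); rewrite lerD2l ler_sqrt.
    by apply: (le_trans (ler_normD _ _)); apply: lerD; [exact: yb|exact: wM].
  by rewrite addr_ge0//; [exact: le_trans (yb n _ sT)|exact: le_trans (wM _ sT)].
have ymono t : t \in `[0, T] -> nondecreasing_seq (fun n => y n.+1 t).
  move=> tT; apply/nondecreasing_seqP => n.
  apply: (strict_comparison T0 (cF n) (cF n.+1) (gF n) (gF n.+1) _ cw _ (ys n) (ys n.+1)) => //.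
    by move=> x; exact: frozen_poly_lt.
  by rewrite lerN2; exact: tepsn.
have ycvg t : t \in `[0, T] -> y m.+1 t @[m --> \oo] --> z t.
  move=> tT; rewrite (cvg_shiftS (fun m => y m t)).
  have : cvgn (fun n => y n.+1 t).
    apply: nondecreasing_is_cvgn; first exact: ymono.
    exists B => _ [n _ <-]; exact: le_trans (ler_norm _) (yb n t tT).
  move=> /cvg_ex[l]; rewrite (cvg_shiftS (fun m => y m t)) => yl.
  by apply/cvg_ex; exists l.
have zlip : lipschitz_on T C z.
  move=> s t sT tT.
  have h : `|y m.+1 t - y m.+1 s| @[m --> \oo] --> `|z t - z s|.
    by apply: cvg_norm; apply: cvgB; apply: ycvg; rewrite in_itv.
  rewrite -(cvg_lim (@Rhausdorff R) h); apply: limr_le; first by apply/cvg_ex; exists `|z t - z s|.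
  by apply: nearW => n; exact: ylip.
have cz := lipschitz_within_continuous C0 zlip.
exists C; split => //; split => // t tT.
rewrite add0r.
have t0T : 0 <= t <= T by rewrite in_itv /= in tT.
have /andP[t0 tleT] := t0T.
pose D := `[0, t]%classic : set R.
have mD : measurable D by exact: measurable_itv.
have DT : D `<=` `[0, T]%classic.
  by move=> s; rewrite /D /= !in_itv /= => /andP[-> h]; exact: le_trans h tleT.
have intD f : lebesgue_measure.-integrable `[0, T] (EFin \o f) ->
    lebesgue_measure.-integrable D (EFin \o f).
  by move=> fi; apply: integrableS fi.
have fi n := intD _ (integrable_along (ltW T0) (mF n) (gF n) cw (ys n).1).
have zi := intD _ (integrable_along (ltW T0) (@measurable_drift R) (@sqrt_growth_drift R) cw cz).
pose f_ n s := (frozen_poly n.+1 (p n.+1) (y n.+1 s + w s))%:E.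
pose f s := (drift (z s + w s))%:E.
pose N := `[0, T]%classic `&` (fun s => w s + z s) @^-1` [set 0].
have mN : measurable N.
  have mX : measurable_fun `[0, T]%classic (fun s => w s + z s).
    by apply: subspace_continuous_measurable_fun => //; exact: within_continuousD.
  by apply: mX => //; exact: measurable_set1.
have N0 : lebesgue_measure N = 0%E.
  by apply: (sparse_null sp C0 zlip mN) => s [sT /= Xs]; split.
have aecvg : {ae lebesgue_measure, forall s, D s -> f_ ^~ s @ \oo --> f s}.
  exists N; split => // s /= /not_implyP[Ds nlim]; split; first exact: DT.
  apply: contrapT => /= X0; apply: nlim.
  have sT : s \in `[0, T] by exact: DT.
  apply/fine_cvgP; split; first by apply: nearW => n.
  rewrite -[_ @ _]/((fun n => frozen_poly n.+1 (p n.+1) (y n.+1 s + w s)) @ \oo).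
  have := @frozen_poly_cvg R p (fun m => y m s + w s) (z s + w s) happ.
  rewrite -(cvg_shiftS (fun n => frozen_poly n (p n) (y n s + w s))); apply.
    by apply/eqP; rewrite addrC.
  rewrite -(cvg_shiftS (fun m => y m s + w s)).
  by apply: cvgD; [exact: ycvg|exact: cvg_cst].
have iC : lebesgue_measure.-integrable D (EFin \o (fun=> C)).
  apply: measurable_bounded_integrable => //=.
  - by rewrite lebesgue_measure_itv /=; case: ifP => _; rewrite ?ltry// -EFinD ltry.
  - by exists `|C|; split; rewrite ?num_real// => b /ltW hb s _.
have bdd : {ae lebesgue_measure, forall s n, D s ->
    (`|f_ n s| <= (EFin \o (fun=> C)) s)%E}.
  apply/aeW => s n Ds; rewrite /f_ /= lee_fin; apply: fC; exact: DT.
have mf_ n : measurable_fun D (f_ n) by exact: measurable_int (fi n).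
have mf : measurable_fun D f by exact: measurable_int zi.
have [_ _ cvgI] := @dominated_convergence _ _ R lebesgue_measure D mD f_ f _ mf_ mf aecvg iC bdd.
have finf : (\int[lebesgue_measure]_(s in D) f s)%E \is a fin_num.
  exact: integrable_fin_num zi.
have cvgR : \int[lebesgue_measure]_(s in D)
      frozen_poly n.+1 (p n.+1) (y n.+1 s + w s) @[n --> \oo] -->
    \int[lebesgue_measure]_(s in D) drift (z s + w s).
  by apply: fine_cvg; rewrite fineK.
have cvgy : y n.+1 t @[n --> \oo] --> \int[lebesgue_measure]_(s in D) drift (z s + w s).
  rewrite -[X in _ --> X]add0r.
  rewrite (_ : (fun n => y n.+1 t) = (fun n => - teps n.+1 +
    \int[lebesgue_measure]_(s in D) frozen_poly n.+1 (p n.+1) (y n.+1 s + w s))); last first.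
    by apply/funext => n; rewrite ((ys n).2 t tT).
  apply: cvgD => //; rewrite -oppr0; apply: cvgN.
  by rewrite (cvg_shiftS teps).
exact: (cvg_unique _ (ycvg t tT) cvgy).
Qed.

Theorem theorem3p3 (R : realType) (d : measure_display)
    (Omega : measurableType d) (P : probability Omega R)
    (T : R) (W : R -> {RV P >-> R})
    (p : nat -> {poly R}) (teps : nat -> R) (Y : nat -> R -> Omega -> R)
    (T_gt0 : 0 < T)
    (W_bm : brownian_motion T W)
    (p_approx : forall n : nat, (0 < n)%N ->
       forall x : R, x \in `[- n%:R, n%:R] ->
       `|drift_n n x - (p n).[x]| < eps_n n)
    (teps_gt0 : forall m : nat, (0 < m)%N -> 0 < teps m)
    (teps_noninc : forall m : nat, (0 < m)%N -> teps m.+1 <= teps m)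
    (teps_cvg0 : teps m @[m --> \oo] --> 0)
    (Y_sol : forall m : nat, (0 < m)%N ->
       {ae P, forall w,
         is_path_solution (frozen_poly m (p m)) T (- teps m)
           (fun t => W t w) (fun t => Y m t w)}) :
  unique_path_by_path_solution drift T W
    (fun t w => lim (Y m t w @[m --> \oo])).
Proof.
have Y_all : {ae P, forall w, forall m, (0 < m)%N ->
    is_path_solution (frozen_poly m (p m)) T (- teps m)
      (fun t => W t w) (fun t => Y m t w)}.
  apply/ae_foralln => m; case: m => [|m]; first by apply/aeW.
  by apply: filterS (Y_sol m.+1 (ltn0Sn m)) => w h _.
apply: filterS3 (bm_continuous W_bm) (ae_sparse_near_zero W_bm T_gt0) Y_all.
move=> w cw sp ysol.
have [K [K0 lip zs]] := limit_path_solution T_gt0 cw sp p_approx teps_gt0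
  teps_noninc teps_cvg0 ysol.
split => // y ys; exact: drift_path_unique T_gt0 cw sp K0 lip zs ys.
Qed.
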